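(* Let $p\in(0,1]$, and suppose that the density function $\rho:\mathbb{R}\to[0,\infty)$ generating the smoothing function $\phi$ satisfies: (1) $\rho(x)=\rho(-x)$ for all $x\in\mathbb{R}$; (2) $\rho$ is continuous, and nonincreasing on $[0,\infty)$; (3) there exist constants $c,q>0$ such that $2\int_0^S\rho(x)\,dx\ge 1-\frac{c}{S^q+c}$ for all $S\ge 0$; (4) if $p=1$, then $\rho(x)>0$ for all $x\in\mathbb{R}$. Let $\{(\omega^k,\lambda^k,\zeta^k,\eta^k)\}$ be a sequence generated by the smoothing algorithm, and suppose that at every accumulation point $(\omega^*,\lambda^* )$ of $\{(\omega^k,\lambda^k)\}$ the MFCQ condition stated in the context holds. If $p=1$, assume also that every accumulation point $(\omega^*,\lambda^* )$ of $\{(\omega^k,\lambda^k)\}$ satisfies $$\max_{i\in I(\omega^* )}\left|\frac{\partial G}{\partial\omega_i}(\omega^*,\bar\lambda^* )\right|<\lambda_1^*\psi'(0)$$ (vacuous if $I(\omega^* )=\emptyset$). If $\{(\omega^k,\lambda^k)\}$ is bounded, then the sequence of Lagrange multiplier vectors $\{(\zeta^k,\eta^k)\}\subseteq\mathbb{R}^n\times\mathbb{R}^r$ is bounded.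
   Context: **Data.** $n,r\ge1$; $f:\mathbb{R}^n\to\mathbb{R}$ is continuously differentiable; $g,R_2,\dots,R_r:\mathbb{R}^n\to\mathbb{R}$ are twice continuously differentiable; $p\in(0,1]$; $\epsilon>0$ is a fixed (small) parameter. The function $\psi:[0,\infty)\to\mathbb{R}$ is twice continuously differentiable on $[0,\infty)$ and there are constants $\alpha,\beta>0$ with $0<\psi'(t)\le\alpha$ and $-\beta\le\psi''(t)\le0$ for all $t\ge0$. For $\lambda=(\lambda_1,\dots,\lambda_r)\in\mathbb{R}^r$ write $\bar\lambda=(\lambda_2,\dots,\lambda_r)$ and $G(\omega,\bar\lambda)=g(\omega)+\sum_{i=2}^r\lambda_iR_i(\omega)$. Let $\Omega_\epsilon=\{\lambda\in\mathbb{R}^r:\lambda_1\ge\epsilon,\ \lambda_i\ge0\ (i\ge2)\}$, $e_1=(1,0,\dots,0)\in\mathbb{R}^r$, $I(\omega)=\{j:\omega_j=0\}$. Inequalities between vectors are componentwise. **Smoothing function.** $\rho:\mathbb{R}\to[0,\infty)$ is a probability density with $\int_{\mathbb{R}}|x|\rho(x)\,dx<\infty$, and for $\mu>0$, $\phi(\mu,x)=\int_{\mathbb{R}}|x-t|\frac1\mu\rho\left(\frac t\mu\right)dt$, $\ \varphi_\mu(\omega)=\sum_{j=1}^n\psi\left([\phi(\mu,\omega_j)]^p\right)$. (Under the hypotheses on $\rho$ in the claim, $\varphi_\mu$ is twice continuously differentiable.) **$\hat\varepsilon$-approximate KKT point.** For $\mu>0$ and $\hat\varepsilon\ge0$, a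 tuple $(\omega,\lambda,\zeta,\eta)\in\mathbb{R}^n\times\mathbb{R}^r\times\mathbb{R}^n\times\mathbb{R}^r$ is an $\hat\varepsilon$-approximate KKT point of the smoothed problem ($\min f(\omega)$ s.t. $\nabla_\omega G(\omega,\bar\lambda)+\lambda_1\nabla\varphi_\mu(\omega)=0$, $\lambda\in\Omega_\epsilon$) if there is $(\varepsilon_1,\varepsilon_2,\varepsilon_3,\varepsilon_4,\varepsilon_5)\in\mathbb{R}^n\times\mathbb{R}\times\mathbb{R}^{r-1}\times\mathbb{R}^n\times\mathbb{R}$ of Euclidean norm at most $\hat\varepsilon$ such that - $\nabla f(\omega)+(\nabla^2_{\omega\omega}G(\omega,\bar\lambda)+\lambda_1\nabla^2\varphi_\mu(\omega))\zeta=\varepsilon_1$, - $\nabla\varphi_\mu(\omega)^T\zeta-\eta_1=\varepsilon_2$, - $\nabla R_j(\omega)^T\zeta-\eta_j=(\varepsilon_3)_{j-1}$ for $j=2,\dots,r$, - $\nabla_\omega G(\omega,\bar\lambda)+\lambda_1\nabla\varphi_\mu(\omega)=\varepsilon_4$, - $\lambda-\epsilon e_1\ge0$, $\eta\ge0$, $(\lambda-\epsilon e_1)^T\eta=\varepsilon_5$. **Smoothing algorithm.** Choose $\mu_0>0$, $\beta_1,\beta_2\in(0,1)$, $\hat\varepsilon_0\ge0$. For $k=0,1,2,\dots$: let $(\omega^{k+1},\lambda^{k+1},\zeta^{k+1},\eta^{k+1})$ be an $\hat\varepsilon_k$-approximate KKT point of the smoothed problem with $\mu=\mu_k$ (such a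 point is assumed to be available at every iteration); set $\mu_{k+1}=\beta_1\mu_k$, $\hat\varepsilon_{k+1}=\beta_2\hat\varepsilon_k$. **MFCQ condition at $(\omega^*,\lambda^* )$.** Let $I(\lambda^* )=\{i\in\{1,\dots,r\}:\lambda_i^*=\epsilon(e_1)_i\}$. For $j\notin I(\omega^* )$ let $\Psi_j(\omega,\lambda)=\Phi_j(\omega,\lambda):=\frac{\partial G(\omega,\bar\lambda)}{\partial\omega_j}+p\operatorname{sgn}(\omega_j)\lambda_1|\omega_j|^{p-1}\psi'(|\omega_j|^p)$, and for $j\in I(\omega^* )$ let $\Psi_j(\omega,\lambda)=\omega_j$. The condition is: $\{\nabla_{(\omega,\lambda)}\Psi_j(\omega^*,\lambda^* )\}_{j=1}^n$ is linearly independent and there exists $\bar d\in\mathbb{R}^{n+r}$ with $\nabla_{(\omega,\lambda)}\Psi_j(\omega^*,\lambda^* )^T\bar d=0$ for all $j=1,\dots,n$, and $(\nabla_{(\omega,\lambda)}\lambda_i)^T\bar d>0$ for all $i\in I(\lambda^* )$ (i.e. the component of $\bar d$ in the coordinate $\lambda_i$ is positive). *)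

(* Defs.v *)
From HB Require Import structures.
From mathcomp Require Export all_boot all_order all_algebra.
From mathcomp Require Export all_classical all_reals all_analysis.
Export Order.TTheory GRing.Theory Num.Theory.
Export numFieldNormedType.Exports.
Set Implicit Arguments.
Unset Strict Implicit.
Unset Printing Implicit Defensive.
Local Open Scope classical_set_scope.
Local Open Scope ring_scope.

(* R^m is the type 'rV[R]_m of row vectors; its topology is the product one.  *)

Section Calculus.
Variable R : realType.
Implicit Types m : nat.

Definition dotp m (u v : 'rV[R]_m) : R := \sum_(i < m) u 0 i * v 0 i.

(* Squared Euclidean norm: the library norm `|u| on 'rV[R]_m is the sup norm. *)
Definition sqnorm m (u : 'rV[R]_m) : R := dotp u u.

Definition unitv m (i : 'I_m) : 'rV[R]_m := delta_mx 0 i.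

Definition mulmxv m (H : 'M[R]_m) (u : 'rV[R]_m) : 'rV[R]_m := (H *m u^T)^T.

Definition partial m (h : 'rV[R]_m -> R) (i : 'I_m) (x : 'rV[R]_m) : R :=
  'D_(unitv i) h x.

Definition grad m (h : 'rV[R]_m -> R) (x : 'rV[R]_m) : 'rV[R]_m :=
  \row_(i < m) partial h i x.

Definition hess m (h : 'rV[R]_m -> R) (x : 'rV[R]_m) : 'M[R]_m :=
  \matrix_(i < m, j < m) partial (partial h j) i x.

Definition C1 m (h : 'rV[R]_m -> R) : Prop :=
  (forall x, differentiable h x) /\ continuous (grad h).

Definition C2 m (h : 'rV[R]_m -> R) : Prop :=
  C1 h /\ forall i, C1 (partial h i).

(* Calculus on [0, +oo[: limits of difference quotients are taken inside the
   half-line, hence are one-sided at 0, and values on ]-oo, 0[ are irrelevant. *)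
Definition quot_nneg (h : R -> R) (t : R) : set_system R :=
  (fun s => (h s - h t) / (s - t)) @ within `[0, +oo[ t^'.

Definition derivable_nneg (h : R -> R) (t : R) : Prop := cvg (quot_nneg h t).

Definition derive_nneg (h : R -> R) (t : R) : R := lim (quot_nneg h t).

Definition C2_nneg (h : R -> R) : Prop :=
  [/\ forall t, 0 <= t -> derivable_nneg h t,
      forall t, 0 <= t -> derivable_nneg (derive_nneg h) t &
      {within `[0, +oo[, continuous (derive_nneg (derive_nneg h))}].

Definition prob_density (rho : R -> R) : Prop :=
  [/\ measurable_fun setT rho, forall x, 0 <= rho x &
      (\int[lebesgue_measure]_x (rho x)%:E = 1)%E].

Definition finite_first_moment (rho : R -> R) : Prop :=
  (\int[lebesgue_measure]_x (`|x| * rho x)%:E < +oo)%E.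

End Calculus.

(* A vector lambda of R^{r+1} has its distinguished component lambda_1 at index
   ord0; the remaining ones, lambda_2, ..., lambda_{r+1}, form lbar lambda, and
   the functions R_2, ..., R_{r+1} are the family Rs indexed by 'I_r. *)
Section Problem.
Variable R : realType.
Variables n r : nat.
Variables (f g : 'rV[R]_n -> R) (Rs : 'I_r -> 'rV[R]_n -> R).
Variables (psi rho : R -> R) (p eps : R).
Implicit Types (w zeta : 'rV[R]_n) (lambda eta : 'rV[R]_r.+1).

Definition lbar lambda : 'rV[R]_r := \row_(i < r) lambda 0 (lift ord0 i).

Definition G w (lb : 'rV[R]_r) : R := g w + \sum_(i < r) lb 0 i * Rs i w.

Definition phi (mu x : R) : R :=
  \int[lebesgue_measure]_t (`|x - t| * (mu^-1 * rho (t / mu))).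

Definition varphi (mu : R) w : R :=
  \sum_(j < n) psi (phi mu (w 0 j) `^ p).

Definition eps_e1 : 'rV[R]_r.+1 := eps *: unitv R ord0.

Definition stationarity (mu : R) w lambda : 'rV[R]_n :=
  grad (G ^~ (lbar lambda)) w + lambda 0 ord0 *: grad (varphi mu) w.

Definition approx_KKT (mu ehat : R) w lambda zeta eta : Prop :=
  exists (e1 : 'rV[R]_n) (e2 : R) (e3 : 'rV[R]_r) (e4 : 'rV[R]_n) (e5 : R),
    Num.sqrt (sqnorm e1 + e2 ^+ 2 + sqnorm e3 + sqnorm e4 + e5 ^+ 2) <= ehat /\
    [/\ grad f w + mulmxv (hess (G ^~ (lbar lambda)) w
                           + lambda 0 ord0 *: hess (varphi mu) w) zeta = e1,
        dotp (grad (varphi mu) w) zeta - eta 0 ord0 = e2,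
        forall j : 'I_r,
          dotp (grad (Rs j) w) zeta - eta 0 (lift ord0 j) = e3 0 j,
        stationarity mu w lambda = e4 &
        [/\ forall i, 0 <= (lambda - eps_e1) 0 i,
            forall i, 0 <= eta 0 i &
            dotp (lambda - eps_e1) eta = e5]].

(* The parameters mu_k and ehat_k are geometric; the terms of index 0 of the
   four sequences are the (unconstrained) starting point. *)
Definition smoothing_sequence (mu0 beta1 beta2 ehat0 : R)
    (omega : nat -> 'rV[R]_n) (lambda : nat -> 'rV[R]_r.+1)
    (zeta : nat -> 'rV[R]_n) (eta : nat -> 'rV[R]_r.+1) : Prop :=
  exists mu ehat : nat -> R,
    [/\ mu 0%N = mu0, forall k, mu k.+1 = beta1 * mu k,
        ehat 0%N = ehat0, forall k, ehat k.+1 = beta2 * ehat k &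
        forall k, approx_KKT (mu k) (ehat k)
          (omega k.+1) (lambda k.+1) (zeta k.+1) (eta k.+1)].

(* The pair (w, lambda) is encoded as the vector row_mx w lambda. *)
Definition accumulation_point
    (omega : nat -> 'rV[R]_n) (lambda : nat -> 'rV[R]_r.+1) w' lambda' : Prop :=
  cluster ((fun k => row_mx (omega k) (lambda k)) @ \oo) (row_mx w' lambda').

Definition Phi (j : 'I_n) w lambda : R :=
  partial (G ^~ (lbar lambda)) j w
  + p * Num.sg (w 0 j) * lambda 0 ord0 * `|w 0 j| `^ (p - 1)
    * derive_nneg psi (`|w 0 j| `^ p).

Definition Psi (w' : 'rV[R]_n) (j : 'I_n) (z : 'rV[R]_(n + r.+1)) : R :=
  if w' 0 j == 0 then lsubmx z 0 j else Phi j (lsubmx z) (rsubmx z).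

Definition MFCQ w' lambda' : Prop :=
  let z' := row_mx w' lambda' in
  row_free (\matrix_(j < n) grad (Psi w' j) z') /\
  exists d : 'rV[R]_(n + r.+1),
    (forall j, dotp (grad (Psi w' j) z') d = 0) /\
    (forall i, lambda' 0 i = eps_e1 0 i -> 0 < rsubmx d 0 i).

End Problem.

(* Main.v *)
(* Write [phi mu x = mu * theta (x / mu)] with [theta y = \int |y - s| rho s ds],
   so that [theta'' = 2 rho].  If the multipliers were unbounded, some subsequence
   of them, divided by its norm, would have a nonzero limit [(zh, hh)]; limits are
   taken along an ultrafilter, so that every bounded sequence converges.
   At a coordinate [j] with [w*_j = 0], approximate stationarity bounds the first
   derivative of the smoothed penalty.  This forces [x / mu] to stay bounded ([p = 1])
   or to tend to 0 ([p < 1]), hence the second derivative, dominated by its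
   [2 rho (x / mu) / mu] part, tends to [+oo], and the first KKT equation gives
   [zh_j = 0].  At the other coordinates the smoothed derivatives converge to those
   of [|x| ^ p].  The limit equations then say that a combination of the gradients of
   the [Psi_j] equals [(0, hh)]; pairing it with the MFCQ direction gives [hh = 0],
   and linear independence gives [zh = 0]. *)
Require Import Defs.
From mathcomp Require Import measurable_realfun ring lra.
Set Implicit Arguments.
Unset Strict Implicit.
Unset Printing Implicit Defensive.
Local Open Scope classical_set_scope.
Local Open Scope ring_scope.

(** * Derivatives of real functions *)

Section RealCalculus.
Variable R : realType.
Implicit Types (f g : R -> R) (x y : R).

(** An [O(h ^ 2)] remainder leaves an error at most [C * |h|] in the difference quotient. This
    allows differentiating an integral from a single estimate of the integrated remainder. *)
Lemma is_derive_quadratic_error f x l C :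
  (forall h, `|f (x + h) - f x - h * l| <= C * h ^+ 2) -> is_derive x 1 f l.
Proof.
move=> fC.
have cv : (fun h : R => h^-1 *: ((f \o shift x) (h *: (1 : R)) - f x)) @ 0^' --> l.
  apply/cvgrPdist_le => e e0; near=> h.
  have h0 : h != 0 by near: h; exact: nbhs_dnbhs_neq.
  rewrite /= /GRing.scale /= mulr1 [h + x]addrC.
  have -> : l - h^-1 * (f (x + h) - f x) = - (h^-1 * (f (x + h) - f x - h * l)).
    by field.
  rewrite normrN normrM normfV.
  have nh0 : 0 < `|h| by rewrite normr_gt0.
  rewrite ler_pdivrMl//; apply: (le_trans (fC h)).
  rewrite -real_normK ?num_real// expr2 mulrA mulrC ler_pM2l//.
  (* [|C| + 1] is a positive divisor whatever the sign of [C]. *)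
  apply: (@le_trans _ _ ((`|C| + 1) * `|h|)).
    by rewrite ler_wpM2r// (le_trans (ler_norm C))// lerDl.
  rewrite -ler_pdivlMl ?ltr_wpDl//.
  near: h; apply: dnbhs0_le; rewrite mulr_gt0// invr_gt0 ltr_wpDl//.
by apply: DeriveDef; [apply/cvg_ex; exists l|exact/cvg_lim].
Unshelve. all: by end_near. Qed.

Lemma is_derive_continuous f (df : R) x : is_derive x 1 f df -> {for x, continuous f}.
Proof. by move=> [d _]; exact/differentiable_continuous/derivable1_diffP. Qed.

Lemma MVT_everywhere f (df : R -> R) x y :
  (forall z : R, is_derive z 1 f (df z)) -> x <= y ->
  exists2 c, x <= c <= y & f y - f x = df c * (y - x).
Proof.
move=> fd xy; have [|c cxy ->] := @MVT_segment R f df _ _ xy (fun z _ => fd z).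
  by apply: continuous_subspaceT => z; exact: is_derive_continuous (fd z).
by exists c => //; move: cxy; rewrite in_itv.
Qed.

End RealCalculus.

(** * The smoothing function *)

Section Smoothing.
Variables (R : realType) (rho : R -> R).
Hypotheses (hrho : prob_density rho) (hmoment : finite_first_moment rho)
  (hrho_even : forall x, rho x = rho (- x)) (hrho_cont : continuous rho)
  (hrho_decr : forall x y, 0 <= x -> x <= y -> rho y <= rho x).
Local Notation mu := (@lebesgue_measure R).

Definition theta (y : R) : R := \int[mu]_s (`|y - s| * rho s).

(* This is [\int Num.sg (y - s) * rho s ds], since [rho] has mass 1. *)
Definition dtheta (y : R) : R := 2 * \int[mu]_(s in `]-oo, y]) rho s - 1.

Let rho_ge0 x : 0 <= rho x. Proof. by case: hrho. Qed.

Lemma density_le0 x : rho x <= rho 0.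
Proof.
have [x0|x0] := leP 0 x; first exact: hrho_decr.
by rewrite hrho_even hrho_decr// oppr_ge0 ltW.
Qed.

Lemma integrable_density : mu.-integrable setT (EFin \o rho).
Proof.
case: hrho => mr r0 r1; apply/integrableP; split; first exact/measurable_EFinP.
under eq_integral do rewrite /= ger0_norm//.
by rewrite r1 ltry.
Qed.

Lemma integrable_density_moment : mu.-integrable setT (EFin \o (fun s => `|s| * rho s)).
Proof.
case: hrho => mr r0 r1; apply/integrableP; split.
  by apply/measurable_EFinP/measurable_funM => //; exact: measurableT_comp.
under eq_integral do rewrite /= ger0_norm ?mulr_ge0//.
exact: hmoment.
Qed.

Let mrho : measurable_fun setT rho. Proof. by case: hrho. Qed.

Let integrable_EFinZl (c : R) (u : R -> R) : mu.-integrable setT (EFin \o u) ->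
  mu.-integrable setT (EFin \o (fun s => c * u s)).
Proof.
move=> iu; rewrite (_ : _ \o _ = (fun s => c%:E * (EFin \o u) s)%E).
  exact: integrableZl.
by apply/funext => s; rewrite /= EFinM.
Qed.

(** The function [(a + b * |s|) * rho s] dominates, and it is integrable because [rho] has finite
    mass and finite first moment. *)
Lemma integrable_density_lin (k : R -> R) (a b : R) : measurable_fun setT k ->
  (forall s, `|k s| <= a + b * `|s|) ->
  mu.-integrable setT (EFin \o (fun s => k s * rho s)).
Proof.
move=> mk kab.
have iab := integrableD measurableT (integrable_EFinZl a integrable_density)
  (integrable_EFinZl b integrable_density_moment).
apply: le_integrable iab => //; first by apply/measurable_EFinP/measurable_funM.
move=> s _ /=; rewrite lee_fin normrM (ger0_norm (rho_ge0 s)).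
apply: le_trans (ler_norm _).
by rewrite mulrA -mulrDl ler_wpM2r.
Qed.

Lemma measurable_dist y : measurable_fun setT (fun s : R => `|y - s|).
Proof. by apply: measurableT_comp => //; apply: measurable_funB. Qed.

Lemma integrable_theta y : mu.-integrable setT (EFin \o (fun s => `|y - s| * rho s)).
Proof.
apply: (@integrable_density_lin _ `|y| 1); first exact: measurable_dist.
by move=> s; rewrite normr_id mul1r ler_normB.
Qed.

Lemma Rintegral_density : \int[mu]_s rho s = 1.
Proof. by case: hrho => _ _; rewrite /Rintegral => ->. Qed.

(** Puts the candidate derivative under one integral over the whole line, so that it can be
    subtracted inside the increment of [theta]. *)
Lemma dtheta_integral y :
  dtheta y = \int[mu]_s ((2 * \1_`]-oo, y] s - 1) * rho s).
Proof.
rewrite /dtheta Rintegral_mkcond.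
have i1 : mu.-integrable setT (EFin \o (fun s => \1_`]-oo, y] s * rho s)).
  apply: (@integrable_density_lin _ 1 0) => // s.
  by rewrite mul0r addr0 ger0_norm ?indic_le1 // indicE.
have -> : \int[mu]_x (rho \_ `]-oo, y]) x = \int[mu]_x (\1_`]-oo, y] x * rho x).
  apply: eq_Rintegral => s _; rewrite patchE indicE.
  by case: (s \in _); rewrite ?mul1r ?mul0r.
rewrite -{2}Rintegral_density -RintegralZl// -RintegralB//; last 2 first.
- under eq_fun do rewrite /= mulrA.
  apply: (@integrable_density_lin (fun s => 2 * \1_`]-oo, y] s) 2 0).
    exact: measurable_funM.
  move=> s; rewrite mul0r addr0 indicE.
  by case: (_ \in _); rewrite ?mulr1 ?mulr0 ?normr0// ger0_norm.
- exact: integrable_density.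
by apply: eq_Rintegral => s _; ring.
Qed.

(* [`|y + h - s| - `|y - s|] equals [h * Num.sg (y - s)] unless [`|s - y| <= `|h|], a
   set of mass [O(h)] on which the error is [O(h)]. *)
Lemma is_derive_theta (y : R) : is_derive y 1 theta (dtheta y).
Proof.
apply: (@is_derive_quadratic_error _ _ _ _ (4 * rho 0)) => h.
have I1 : mu.-integrable setT (EFin \o (fun s => (2 * \1_`]-oo, y] s - 1) * rho s)).
  apply: (@integrable_density_lin _ 1 0).
    by apply: measurable_funB => //; apply: measurable_funM.
  move=> s; rewrite mul0r addr0 indicE; case: (_ \in _); rewrite ?mulr1 ?mulr0.
    by rewrite [X in `|X|](_ : _ = 1) ?normr1//; ring.
  by rewrite sub0r normrN normr1.
have I2 : mu.-integrable setT
    (EFin \o (fun s => h * ((2 * \1_`]-oo, y] s - 1) * rho s))).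
  exact: integrable_EFinZl.
have I3 : mu.-integrable setT
    (EFin \o (fun s => `|y + h - s| * rho s - `|y - s| * rho s)).
  by apply: (integrableB measurableT (integrable_theta _) (integrable_theta _)).
rewrite dtheta_integral /theta -RintegralB//; try exact: integrable_theta.
rewrite -RintegralZl// -RintegralB//.
have I4 : mu.-integrable setT
    (EFin \o (fun s => `|y + h - s| * rho s - `|y - s| * rho s
                      - h * ((2 * \1_`]-oo, y] s - 1) * rho s))).
  exact: (integrableB measurableT I3 I2).
apply: le_trans (le_normr_Rintegral _ I4) _ => //.
pose J := `[y - `|h|, y + `|h|].
have mJ : measurable [set` J] by exact: measurable_itv.
have muJ : mu [set` J] = (2 * `|h|)%:E.
  rewrite /J lebesgue_measure_itv/= lte_fin.
  case: ltP => [_|]; first by rewrite -EFinB; congr EFin; ring.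
  by move: (normr_ge0 h) => A B; congr EFin; lra.
(* [J] has length [2 * |h|], and on it the integrand is at most [2 * |h| * rho 0]; hence the
   constant 4. *)
have -> : 4 * rho 0 * h ^+ 2 = \int[mu]_(s in [set` J]) (2 * `|h| * rho 0).
  by rewrite Rintegral_cst// [X in fine X]muJ /= -real_normK ?num_real//; ring.
rewrite [leRHS]Rintegral_mkcond; apply: le_Rintegral => //.
- by apply: integrable_norm I4.
- rewrite -restrict_EFin.
  apply: (iffLR (@integrable_mkcond _ _ R mu [set` J]
    (EFin \o (fun=> 2 * `|h| * rho 0)) _)) => //.
  apply: continuous_compact_integrable; first exact: segment_compact.
  by apply: continuous_subspaceT => ?; exact: cvg_cst.
- move=> s _; rewrite patchE.
  rewrite [X in `|X|](_ : _ =
    (`|y + h - s| - `|y - s| - h * (2 * \1_`]-oo, y] s - 1)) * rho s); last by ring.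
  rewrite normrM (ger0_norm (rho_ge0 s)).
  have [sJ|] := ifPn.
    apply: ler_pM => //; last exact: density_le0.
    have : `| `|y + h - s| - `|y - s| | <= `|h|.
      by apply: le_trans (ler_dist_dist _ _) _; rewrite (_ : _ - _ = h)//; ring.
    have : `|h * (2 * \1_`]-oo, y] s - 1)| <= `|h|.
      rewrite normrM ler_piMr// indicE.
      case: (_ \in _); rewrite ?mulr1 ?mulr0 ?sub0r ?normrN ?normr1//.
      by rewrite [X in `|X|](_ : _ = 1) ?normr1//; ring.
    move=> A B; apply: le_trans (ler_normB _ _) _; lra.
  rewrite mem_setE /J in_itv /= negb_and -!ltNge => sJ.
  suff -> : `|y + h - s| - `|y - s| - h * (2 * \1_`]-oo, y] s - 1) = 0.
    by rewrite normr0 mul0r.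
  have [h1 h2] : h <= `|h| /\ - h <= `|h| by rewrite -{2}normrN !ler_norm.
  rewrite indicE mem_setE in_itv /=; have [sy|ys] := leP s y; rewrite /=.
    by rewrite !ger0_norm; [ring| |]; case/orP: sJ; lra.
  by rewrite !ltr0_norm; [ring| |]; case/orP: sJ; lra.
Qed.

Lemma is_derive_dtheta (y : R) : is_derive y 1 dtheta (2 * rho y).
Proof.
have yy1 : y < y + 1 by rewrite ltrDl.
have iy : mu.-integrable `]-oo, y + 1] (EFin \o rho).
  exact: integrableS integrable_density.
have [d <-] := continuous_FTC1 yy1 iy (ltNyr y) (@hrho_cont y).
have := is_deriveB (is_deriveZ 2 (derivableP d)) (is_derive_cst (1:R) y 1).
by rewrite subr0 derive1E.
Qed.

(** Together with [dtheta0], this identifies the integral of the tail hypothesis with [dtheta S]. *)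
Lemma dtheta_itv S : 0 <= S -> dtheta S - dtheta 0 = 2 * \int[mu]_(s in `[0, S]) rho s.
Proof.
move=> S0; rewrite /dtheta.
have iS D : measurable D -> mu.-integrable D (EFin \o rho).
  by move=> mD; apply: integrableS integrable_density.
rewrite -Rintegral_itv_obnd_cbnd; last exact: iS.
by rewrite -(@Rintegral_itvB _ rho -oo%O (BRight S) 0);
  [ring|exact: iS|rewrite bnd_simp|rewrite bnd_simp].
Qed.

(** By symmetry each half-line carries mass 1/2. *)
Lemma dtheta0 : dtheta 0 = 0.
Proof.
have := ge0_symfun_integralT rho_ge0 hrho_cont (fun x => hrho_even x).
case: hrho => _ _ ->.
have iS D : measurable D -> mu.-integrable D (EFin \o rho).
  by move=> mD; apply: integrableS integrable_density.
rewrite -set_itvcy => E.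
have {}E : 1 = 2 * \int[mu]_(s in `[0, +oo[) rho s.
  apply: EFin_inj; rewrite EFinM /Rintegral fineK//.
  by apply: integrable_fin_num => //; exact: iS.
have := @Rintegral_itvB R rho -oo%O +oo%O 0.
rewrite set_itvE Rintegral_density => /(_ integrable_density isT isT).
rewrite Rintegral_itv_obnd_cbnd; last exact: iS.
move: E; rewrite /dtheta; clear iS.
move: (Rintegral mu `[0, +oo[ rho) (Rintegral mu `]-oo, 0] rho) => a b; lra.
Qed.

(** [dtheta y] is the mass to the left of [y] minus the mass to its right, and these two masses add
    up to 1. *)
Lemma dtheta_norm_le1 y : `|dtheta y| <= 1.
Proof.
rewrite /dtheta.
have := @Rintegral_itvB R rho -oo%O +oo%O y.
rewrite set_itvE Rintegral_density => /(_ integrable_density isT isT) E.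
have A : 0 <= \int[mu]_(t in `]-oo, y]) rho t by apply: Rintegral_ge0.
have B : 0 <= \int[mu]_(t in `]y, +oo[) rho t by apply: Rintegral_ge0.
move: E A B; rewrite ler_norml.
move: (Rintegral mu `]-oo, y] rho) (Rintegral mu `]y, +oo[ rho) => a b; lra.
Qed.

(** Integrate the triangle inequality [| |y - s| - |y| | <= |s|] against [rho]; [theta 0] is the
    first absolute moment. *)
Lemma theta_dist y : `|theta y - `|y| | <= theta 0.
Proof.
have -> : `|y| = \int[mu]_s (`|y| * rho s).
  by rewrite RintegralZl ?Rintegral_density ?mulr1//; exact: integrable_density.
have Iy : mu.-integrable setT (EFin \o (fun s => `|y| * rho s)).
  apply: (@integrable_density_lin (cst `|y|) `|y| 0) => // s.
  by rewrite normr_id mul0r addr0.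
rewrite /theta -RintegralB//; last exact: integrable_theta.
have I : mu.-integrable setT (EFin \o (fun s => `|y - s| * rho s - `|y| * rho s)).
  by apply: (integrableB measurableT (integrable_theta _) Iy).
apply: le_trans (le_normr_Rintegral _ I) _ => //.
apply: le_Rintegral => //; [exact: integrable_norm I|exact: integrable_theta|].
move=> s _; rewrite -mulrBl normrM (ger0_norm (rho_ge0 s)) ler_wpM2r//.
by apply: le_trans (ler_dist_dist _ _) _; rewrite addrAC subrr.
Qed.

(** Substitute [t = m * s] in the integral defining [phi]. *)
Lemma phi_theta m x : 0 < m -> phi rho m x = m * theta (x / m).
Proof.
move=> m0; rewrite /phi /theta.
have dF (s : R) : is_derive s 1 (fun s : R => m * s) m.
  by rewrite -[X in is_derive _ _ _ X]mulr1; exact: is_deriveZ.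
have F' : derive1 (fun s : R => m * s) = cst m.
  by apply/funext => s; rewrite derive1E derive_val.
rewrite -RintegralZl//; last exact: integrable_theta.
rewrite /Rintegral (@increasing_ge0_integration_by_substitutionT _ (fun s => m * s)).
- congr fine; apply: eq_integral => s _; congr EFin.
  rewrite F'.
  change (`|x - m * s| * (m^-1 * rho (m * s / m)) * m =
    m * (`|x / m - s| * rho s)).
  have -> : m * s / m = s by rewrite mulrAC mulfV ?gt_eqF// mul1r.
  have -> : `|x - m * s| = m * `|x / m - s|.
    rewrite -{2}(gtr0_norm m0) -normrM; congr `|_|; field; exact: lt0r_neq0.
  by field; exact: lt0r_neq0.
- by move=> a b; rewrite ltr_pM2l.
- by rewrite F' => s; exact: cvg_cst.
- by rewrite F'; exact: is_cvg_cst.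
- by rewrite F'; exact: is_cvg_cst.
- by [].
- exact: gt0_cvgMrNy.
- exact: gt0_cvgMry.
- move=> s; apply: cvgM.
    by apply: cvg_norm; apply: cvgB; [exact: cvg_cst|exact: cvg_id].
  apply: cvgM; first exact: cvg_cst.
  apply: (@cvg_comp _ _ _ (fun t => t / m) rho); last exact: hrho_cont.
  by apply: mulrr_continuous.
- by move=> s; rewrite !mulr_ge0// invr_ge0 ltW.
Qed.

Lemma dtheta_homo : {homo dtheta : x y / x <= y}.
Proof.
move=> x y xy; have [c _ E] := MVT_everywhere is_derive_dtheta xy.
by rewrite -subr_ge0 E mulr_ge0 ?subr_ge0// mulr_ge0.
Qed.

(** The sum [dtheta y + dtheta (- y)] vanishes at 0, and its derivative [2 * rho y - 2 * rho (- y)]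
    is zero because [rho] is even. *)
Lemma dthetaN y : dtheta (- y) = - dtheta y.
Proof.
wlog y0 : y / 0 <= y => [H|].
  have [y0|/ltW y0] := leP 0 y; first exact: H.
  by rewrite -{2}(opprK y) (H (- y)) ?opprK ?oppr_ge0.
have D (z : R) := is_deriveD (is_derive_dtheta z)
  (is_derive1_comp (is_derive_dtheta (- z)) (is_deriveNid z 1)).
have [c _] := MVT_everywhere D y0.
rewrite !fctE /= oppr0 dtheta0 -hrho_even; lra.
Qed.

Lemma dtheta_ge0 y : 0 <= y -> 0 <= dtheta y.
Proof. by move=> y0; rewrite -dtheta0; exact: dtheta_homo. Qed.

Lemma dtheta_abs y : dtheta y = Num.sg y * dtheta `|y|.
Proof.
have [y0|y0|->] := ltrgt0P y; last by rewrite dtheta0 sgr0 mul0r.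
  by rewrite gtr0_sg// mul1r.
by rewrite ltr0_sg// dthetaN mulN1r opprK.
Qed.

Lemma density_abs y : rho y = rho `|y|.
Proof. by have [] := ger0P y => _ //; exact: hrho_even. Qed.

Lemma dtheta_le_linear y : 0 <= y -> dtheta y <= 2 * rho 0 * y.
Proof.
move=> y0; have [c _] := MVT_everywhere is_derive_dtheta y0.
rewrite dtheta0 !subr0 => ->; apply: ler_wpM2r => //.
by apply: ler_wpM2l => //; exact: density_le0.
Qed.

Lemma theta_min y : theta 0 <= theta y.
Proof.
have [y0|/ltW y0] := leP 0 y.
  have [c /andP[c0 _] E] := MVT_everywhere is_derive_theta y0.
  by rewrite -subr_ge0 E; apply: mulr_ge0; rewrite ?subr0//; exact: dtheta_ge0.
have [c /andP[_ c0] E] := MVT_everywhere is_derive_theta y0.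
rewrite -subr_le0 E; apply: mulr_le0_ge0; last by rewrite sub0r oppr_ge0.
by rewrite -dtheta0; exact: dtheta_homo.
Qed.

(* [y - theta 0 <= theta y <= theta 0 + 2 rho 0 y ^ 2] at a small [y]. *)
Lemma theta0_gt0 : 0 < theta 0.
Proof.
pose y := (2 * rho 0 + 1)^-1 : R.
have r0 : 0 < 2 * rho 0 + 1 by rewrite ltr_wpDl// mulr_ge0.
have y0 : 0 < y by rewrite invr_gt0.
have [c /andP[c0 cy] E] := MVT_everywhere is_derive_theta (ltW y0).
have L : dtheta c * (y - 0) <= 2 * rho 0 * y * y.
  rewrite subr0; apply: ler_wpM2r; first exact: ltW.
  apply: le_trans (dtheta_le_linear c0) _.
  by apply: ler_wpM2l => //; rewrite mulr_ge0.
have := theta_dist y; rewrite (gtr0_norm y0) ler_norml.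
have yr : 2 * rho 0 * y * y = y - y * y.
  by rewrite /y; field; exact: lt0r_neq0.
have : 0 < y * y by rewrite mulr_gt0.
move: L; rewrite yr -E; lra.
Qed.

Lemma theta_gt0 y : 0 < theta y.
Proof. exact: lt_le_trans theta0_gt0 (theta_min y). Qed.

(** On [[y / 2, y]] the derivative of [dtheta] is at least [2 * rho y]. The right-hand side tends to
    0 at infinity as soon as [dtheta] has a limit there. *)
Lemma density_tail_le y : 0 <= y -> y * rho y <= dtheta y - dtheta (y / 2).
Proof.
move=> y0; have y2 : y / 2 <= y by lra.
have [c /andP[c0 cy] ->] := MVT_everywhere is_derive_dtheta y2.
have : rho y <= rho c by apply: hrho_decr => //; apply: le_trans c0; rewrite divr_ge0.
move=> rc; rewrite (_ : 2 * rho c * _ = y * rho c); last by field.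
exact: ler_wpM2l.
Qed.

Lemma is_derive_phi (m x : R) : 0 < m ->
  is_derive x 1 (phi rho m) (dtheta (x / m)).
Proof.
move=> m0.
have -> : phi rho m = m \*: (theta \o (fun z => m^-1 * z)).
  by apply/funext => z; rewrite phi_theta//= [m^-1 * z]mulrC.
have D : is_derive x 1 (fun z : R => m^-1 * z) (m^-1 * 1).
  exact: (is_deriveZ m^-1 (is_derive_id x 1)).
have D2 := is_deriveZ m (is_derive1_comp (is_derive_theta (m^-1 * x)) D).
apply: is_derive_eq D2 _.
by rewrite /GRing.scale /= mulr1 mulrCA mulfV ?gt_eqF// mulr1 mulrC.
Qed.

Lemma is_derive_dphi (m x : R) : 0 < m ->
  is_derive x 1 (fun z => dtheta (z / m)) (2 * rho (x / m) / m).
Proof.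
move=> m0.
have D : is_derive x 1 (fun z : R => m^-1 * z) (m^-1 * 1).
  exact: (is_deriveZ m^-1 (is_derive_id x 1)).
have := is_derive1_comp (is_derive_dtheta (m^-1 * x)) D.
by rewrite mulr1 [m^-1 * x]mulrC; under eq_fun do rewrite /= mulrC.
Qed.

Lemma phi_gt0 m x : 0 < m -> 0 < phi rho m x.
Proof. by move=> m0; rewrite phi_theta// mulr_gt0// theta_gt0. Qed.

Lemma phi_dist m x : 0 < m -> `|phi rho m x - `|x| | <= m * theta 0.
Proof.
move=> m0; rewrite phi_theta//.
rewrite (_ : _ - _ = m * (theta (x / m) - `|x / m|)).
  by rewrite normrM gtr0_norm// ler_pM2l// theta_dist.
by rewrite normrM normfV (gtr0_norm m0); field; exact: lt0r_neq0.
Qed.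

(** * Limits of the smoothing function and of its derivatives as the parameter tends to 0 *)

Section Tail.
Hypothesis hrho_tail : exists c q : R, [/\ 0 < c, 0 < q & forall S : R, 0 <= S ->
     1 - c / (S `^ q + c) <= 2 * \int[lebesgue_measure]_(x in `[0, S]) rho x].

Lemma dtheta_cvg1 : dtheta y @[y --> +oo] --> (1 : R).
Proof.
case: hrho_tail => c [q [c0 q0 hS]].
apply/cvgrPdist_le => e e0; near=> y.
have y0 : 0 <= y by near: y; apply: nbhs_pinfty_ge; rewrite num_real.
have d1 : dtheta y <= 1 by exact: le_trans (ler_norm _) (dtheta_norm_le1 y).
rewrite ger0_norm ?subr_ge0//.
have := hS y y0; rewrite -dtheta_itv// dtheta0 subr0 => A.
rewrite lerBlDl.
apply: (@le_trans _ _ (1 - c / (y `^ q + c) + e)); last by rewrite lerD2r.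
(* If [c <= e * y ^ q], then [c / (y ^ q + c) <= e]. The threshold on [y] itself is the power
   [1 / q] of [c / e]. *)
suff : e^-1 * c <= y `^ q.
  rewrite ler_pdivrMl// => cy; rewrite -addrA lerDl addrC subr_ge0.
  rewrite ler_pdivrMr ?ltr_wpDl ?powR_ge0// mulrDr.
  by rewrite (le_trans cy)// lerDl mulr_ge0 ?ltW.
rewrite -[leLHS]powRr1; last by rewrite ltW// mulr_gt0 ?invr_gt0.
rewrite -(mulVf (lt0r_neq0 q0)) powRrM.
apply: (ge0_ler_powR (ltW q0)); rewrite ?nnegrE ?powR_ge0//.
Unshelve. all: by end_near. Qed.

Lemma density_tail_cvg0 : y * rho y @[y --> +oo] --> (0 : R).
Proof.
apply: (@squeeze_cvgr _ _ _ _ (cst 0) (fun y => dtheta y - dtheta (y / 2))).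
- near=> y; have y0 : 0 <= y by near: y; apply: nbhs_pinfty_ge; rewrite num_real.
  by rewrite /cst mulr_ge0//= density_tail_le.
- exact: cvg_cst.
- rewrite -(subrr (1 : R)); apply: cvgB; first exact: dtheta_cvg1.
  apply: cvg_comp dtheta_cvg1.
  apply/cvgryPge => M; near=> z; rewrite ler_pdivlMr//.
Unshelve. all: by end_near. Qed.

Section Limits.
Variables (T : Type) (U : set_system T) (FU : ProperFilter U).
Variables (m x : T -> R) (x0 : R).
Hypotheses (m_gt0 : forall k, 0 < m k) (m_cvg : m @ U --> (0 : R))
  (x_cvg : x @ U --> x0).

Lemma phi_cvg : phi rho (m k) (x k) @[k --> U] --> `|x0|.
Proof.
have A : `|x k| @[k --> U] --> `|x0| by exact: cvg_norm.
have B : m k * theta 0 @[k --> U] --> 0.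
  by rewrite -[X in _ --> X](mul0r (theta 0)); apply: cvgMr_tmp.
apply: (@squeeze_cvgr _ _ _ _ (fun k => `|x k| - m k * theta 0)
  (fun k => `|x k| + m k * theta 0)).
- near=> k; have := phi_dist (x k) (m_gt0 k); rewrite ler_norml; lra.
- by have := cvgB A B; rewrite subr0; exact.
- by have := cvgD A B; rewrite addr0; exact.
Unshelve. all: by end_near. Qed.

Hypothesis x0_neq0 : x0 != 0.

Let ratio_cvg : `|x k / m k| @[k --> U] --> +oo.
Proof.
have nx0 : 0 < `|x0| by rewrite normr_gt0.
have A : `|x k| @[k --> U] --> `|x0| by exact: cvg_norm.
apply/cvgryPge => M; near=> k.
rewrite normrM normfV (gtr0_norm (m_gt0 k)) ler_pdivlMr//.
apply: (@le_trans _ _ (`|x0| / 2)); last first.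
  by near: k; apply: (cvgr_ge _ A); rewrite ltr_pdivrMr// ltr_pMr// ltr1n.
apply: (@le_trans _ _ ((`|M| + 1) * m k)).
  by apply: ler_wpM2r; rewrite ?(ltW (m_gt0 _))// (le_trans (ler_norm M))// lerDl.
rewrite -ler_pdivlMl ?ltr_wpDl//.
near: k; apply: (cvgr_le _ m_cvg); rewrite mulr_gt0 ?invr_gt0 ?ltr_wpDl//.
by rewrite divr_gt0.
Unshelve. all: by end_near. Qed.

Lemma dphi_cvg : dtheta (x k / m k) @[k --> U] --> Num.sg x0.
Proof.
have D : Num.sg x0 * dtheta `|x k / m k| @[k --> U] --> Num.sg x0.
  rewrite -[X in _ --> X]mulr1; apply: cvgMl_tmp.
  exact: cvg_comp ratio_cvg dtheta_cvg1.
have sg_x : \forall k \near U, Num.sg x0 = Num.sg (x k).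
  have [x0p|x0n|/eqP] := ltrgt0P x0; last by rewrite (negbTE x0_neq0).
    by near=> k; rewrite !gtr0_sg//; near: k; exact: (cvgr_gt _ x_cvg).
  by near=> k; rewrite !ltr0_sg//; near: k; exact: (cvgr_lt _ x_cvg).
apply: cvg_trans D; apply: near_eq_cvg; near=> k.
rewrite [RHS]dtheta_abs sgrM (gtr0_sg (_ : 0 < (m k)^-1)) ?invr_gt0// mulr1.
by congr (_ * _); near: k.
Unshelve. all: by end_near. Qed.

(** The quantity equals [2 * (t * rho t) / |x|] with [t = |x / m|]; here [t] tends to infinity and
    [|x|] stays away from 0. *)
Lemma ddphi_cvg : 2 * rho (x k / m k) / m k @[k --> U] --> (0 : R).
Proof.
have nx0 : `|x0| != 0 by rewrite normr_eq0.
have A : `|x k| @[k --> U] --> `|x0| by exact: cvg_norm.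
have D : 2 * (`|x k / m k| * rho `|x k / m k|) / `|x k| @[k --> U] --> (0 : R).
  rewrite -[X in _ --> X](mul0r `|x0|^-1) -(mulr0 2).
  apply: cvgM; last exact: cvgV.
  by apply: cvgMl_tmp; exact: cvg_comp ratio_cvg density_tail_cvg0.
apply: cvg_trans D; apply: near_eq_cvg; near=> k.
rewrite -density_abs normrM normfV (gtr0_norm (m_gt0 k)); field.
rewrite (lt0r_neq0 (m_gt0 k)) /= normr_eq0.
by near: k; exact: (cvgr_neq0 _ x_cvg).
Unshelve. all: by end_near. Qed.

End Limits.
End Tail.
End Smoothing.

(** * The penalty and the blow-up of its second derivative *)

(** Near 0 the penalty is only controlled from the right; positivity of [K] turns convergence to 0
    into convergence from that side. *)
Lemma cvg_at_right0 (R : realType) (T : Type) (U : set_system T) (FU : ProperFilter U)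
    (K : T -> R) : (forall k, 0 < K k) -> K @ U --> (0 : R) -> K @ U --> 0^'+.
Proof.
move=> k0 cK A; rewrite /at_right /within /= => H.
have : \forall k \near U, 0 < K k -> A (K k) := cK _ H.
by apply: filterS => k; apply.
Qed.

(** * One-sided calculus on the half-line *)

Section HalfLine.
Variable R : realType.
Implicit Types (h : R -> R) (t : R).

(** Around [t > 0] the constraint of staying in the half-line is eventually satisfied, so the
    restricted quotient is the ordinary one. *)
Lemma is_derive_nneg h t : 0 < t -> derivable_nneg h t ->
  is_derive t 1 h (derive_nneg h t).
Proof.
move=> t0 dh; rewrite /derive_nneg.
have cv : (fun e : R => e^-1 *: ((h \o shift t) (e *: (1 : R)) - h t)) @ 0^'
    --> lim (quot_nneg h t).
  apply/cvgrPdist_le => e e0.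
  have /cvgrPdist_le/(_ _ e0) H := dh; rewrite /dnbhs /within /= in H.
  have {}H : \forall s \near t, s != t ->
      `|lim (quot_nneg h t) - (h s - h t) / (s - t)| <= e.
    near=> s => st; have : `[0, +oo[%classic s.
      rewrite /= in_itv/= andbT; apply: ltW.
      by near: s; exact: lt_nbhsr.
    by move: st; near: s; exact: H.
  rewrite (near_shift 0) in H.
  have {}H : \forall s \near (0 : R)^', s + t != t ->
      `|lim (quot_nneg h t) - (h (s + t) - h t) / (s + t - t)| <= e.
    by apply: cvg_within; move: H; rewrite subr0.
  near=> s; have s0 : s != 0 by near: s; exact: nbhs_dnbhs_neq.
  rewrite /= /GRing.scale /= mulr1 mulrC.
  have : s + t != t by rewrite -subr_eq0 addrK.
  by rewrite -[X in _ / X](addrK t); near: s.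
by apply: DeriveDef; [apply/cvg_ex; exists (lim (quot_nneg h t))|exact/cvg_lim].
Unshelve. all: by end_near. Qed.

(** Write the increment as quotient times [s]. Applied to [psi'], this gives the limit of
    [psi' (K ^ p)] when [K] tends to 0. *)
Lemma derivable_nneg_continuous0 h : derivable_nneg h 0 -> h @ 0^'+ --> h 0.
Proof.
move=> dh; set l := lim (quot_nneg h 0).
have Q : (h s - h 0) / s @[s --> 0^'+] --> l.
  apply/cvgrPdist_le => e e0.
  have /cvgrPdist_le/(_ _ e0) H := dh; rewrite /dnbhs /within /= in H.
  have {}H : \forall s \near 0^'+, s != 0 -> s \in `[0, +oo[ ->
      `|l - (h s - h 0) / (s - 0)| <= e.
    by apply: cvg_within; exact: H.
  near=> s; have s0 : 0 < s by near: s; exact: nbhs_right_gt.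
  rewrite -[X in _ / X]subr0; move: (gt_eqF s0) (ltW s0) => /negbT s0' s0''.
  have : s \in `[0, +oo[ by rewrite in_itv/= andbT.
  by move: s0'; near: s.
have D : (h s - h 0) / s * s + h 0 @[s --> 0^'+] --> l * 0 + h 0.
  apply: cvgD; last exact: cvg_cst.
  by apply: cvgM => //; exact/cvg_at_right_filter/cvg_id.
rewrite mulr0 add0r in D; apply: cvg_trans D; apply: near_eq_cvg; near=> s.
by rewrite divfK ?subrK// gt_eqF.
Unshelve. all: by end_near. Qed.

End HalfLine.

(** * Chain rule for the penalty away from the singularity *)

Section Penalty.
Variables (R : realType) (psi : R -> R) (p : R).
Hypothesis hpsi : C2_nneg psi.
Local Notation psi1 := (derive_nneg psi).
Local Notation psi2 := (derive_nneg (derive_nneg psi)).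

Lemma is_derive_psi (t : R) : 0 < t -> is_derive t 1 psi (psi1 t).
Proof.
move=> t0; apply: is_derive_nneg => //.
by case: hpsi => + _ _; apply; exact: ltW.
Qed.

Lemma is_derive_psi1 (t : R) : 0 < t -> is_derive t 1 psi1 (psi2 t).
Proof.
move=> t0; apply: is_derive_nneg => //.
by case: hpsi => _ + _; apply; exact: ltW.
Qed.

Lemma psi2_continuous (t : R) : 0 < t -> {for t, continuous psi2}.
Proof.
move=> t0; case: hpsi => _ _ H.
have {}H : {within `]0, +oo[, continuous psi2}.
  by apply: continuous_subspaceW H => s /=; rewrite !in_itv/= !andbT => /ltW.
move: H; rewrite continuous_open_subspace; last exact: interval_open.
by apply; rewrite inE /= in_itv/= andbT.
Qed.

(* [K], [a], [b] stand for the values of the inner function and of its first two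
   derivatives in the chain rule for [psi (K `^ p)]. *)
Definition dpen (K a : R) : R := psi1 (K `^ p) * (p * K `^ (p - 1)) * a.

Definition ddpen (K a b : R) : R :=
  psi2 (K `^ p) * (p * K `^ (p - 1) * a) ^+ 2
  + psi1 (K `^ p) * (p * ((p - 1) * K `^ (p - 1 - 1)) * a ^+ 2
                     + p * K `^ (p - 1) * b).

Lemma is_derive_pen (k : R -> R) (x a : R) : 0 < k x ->
  is_derive x 1 k a -> is_derive x 1 (fun y => psi (k y `^ p)) (dpen (k x) a).
Proof.
move=> k0 dk.
have D1 := is_derive1_comp (is_derive1_powR p k0) dk.
have D2 := @is_derive1_comp _ _ (fun y => k y `^ p) _ _ _
  (is_derive_psi (powR_gt0 p k0)) D1.
by apply: is_derive_eq D2 _; rewrite /dpen mulrA.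
Qed.

Lemma is_derive_dpen (k k1 : R -> R) (x b : R) : 0 < k x ->
  is_derive x 1 k (k1 x) -> is_derive x 1 k1 b ->
  is_derive x 1 (fun y => dpen (k y) (k1 y)) (ddpen (k x) (k1 x) b).
Proof.
move=> k0 dk dk1.
have D1 := is_derive1_comp (is_derive1_powR p k0) dk.
have D2 := @is_derive1_comp _ _ (fun y => k y `^ p) _ _ _
  (is_derive_psi1 (powR_gt0 p k0)) D1.
have D3 := is_derive1_comp (is_derive1_powR (p - 1) k0) dk.
have D := is_deriveM (is_deriveM D2 (is_deriveZ p D3)) dk1.
apply: is_derive_eq D _.
rewrite /ddpen; change (psi1 (k x `^ p) * (p * k x `^ (p - 1)) * b + k1 x *
  (psi1 (k x `^ p) * (p * ((p - 1) * k x `^ (p - 1 - 1) * k1 x)) +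
   p * k x `^ (p - 1) * (psi2 (k x `^ p) * (p * k x `^ (p - 1) * k1 x))) = 
  psi2 (k x `^ p) * (p * k x `^ (p - 1) * k1 x) ^+ 2 + psi1 (k x `^ p) *
  (p * ((p - 1) * k x `^ (p - 1 - 1)) * k1 x ^+ 2 + p * k x `^ (p - 1) * b)).
ring.
Qed.

Section Limits.
Variables (T : Type) (U : set_system T) (FU : ProperFilter U).
Variables (K a b : T -> R).

Lemma powR_cvg r (K0 : R) : 0 < K0 -> K @ U --> K0 -> K k `^ r @[k --> U] --> K0 `^ r.
Proof.
by move=> k0 cK; apply: (cvg_comp _ _ cK (is_derive_continuous (is_derive1_powR r k0))).
Qed.

Lemma dpen_cvg (K0 a0 : R) : 0 < K0 -> K @ U --> K0 -> a @ U --> a0 ->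
  dpen (K k) (a k) @[k --> U] --> dpen K0 a0.
Proof.
move=> k0 cK ca; have kp := powR_gt0 p k0.
apply: cvgM => //; apply: cvgM.
  apply: continuous_cvg; last exact: powR_cvg.
  exact: is_derive_continuous (is_derive_psi1 kp).
by apply: cvgM; [exact: cvg_cst|exact: powR_cvg].
Qed.

Lemma ddpen_cvg (K0 a0 b0 : R) : 0 < K0 -> K @ U --> K0 -> a @ U --> a0 ->
  b @ U --> b0 -> ddpen (K k) (a k) (b k) @[k --> U] --> ddpen K0 a0 b0.
Proof.
move=> k0 cK ca cb; have kp := powR_gt0 p k0.
have c1 : p * K k `^ (p - 1) @[k --> U] --> p * K0 `^ (p - 1).
  by apply: cvgM; [exact: cvg_cst|exact: powR_cvg].
have c2 : psi1 (K k `^ p) @[k --> U] --> psi1 (K0 `^ p).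
  apply: continuous_cvg; last exact: powR_cvg.
  exact: is_derive_continuous (is_derive_psi1 kp).
have c3 : psi2 (K k `^ p) @[k --> U] --> psi2 (K0 `^ p).
  by apply: continuous_cvg; [exact: psi2_continuous|exact: powR_cvg].
rewrite /ddpen !expr2; apply: cvgD.
  by apply: cvgM => //; apply: cvgM; apply: cvgM.
apply: cvgM => //; apply: cvgD; last exact: cvgM.
apply: cvgM; last exact: cvgM.
apply: cvgM; first exact: cvg_cst.
by apply: cvgM; [exact: cvg_cst|exact: powR_cvg].
Qed.

End Limits.
End Penalty.

(** * Blow-up of the second derivative at a coordinate tending to 0 *)

Section Blowup.
Variables (R : realType) (psi rho : R -> R) (p beta : R).
Hypotheses (hp : 0 < p <= 1) (hbeta : 0 < beta)
  (hpsi : C2_nneg psi)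
  (hpsi1 : forall t, 0 <= t -> 0 < derive_nneg psi t)
  (hpsi2 : forall t, 0 <= t -> - beta <= derive_nneg (derive_nneg psi) t <= 0)
  (hrho : prob_density rho) (hmoment : finite_first_moment rho)
  (hrho_even : forall x, rho x = rho (- x)) (hrho_cont : continuous rho)
  (hrho_decr : forall x y, 0 <= x -> x <= y -> rho y <= rho x)
  (hrho_tail : exists c q : R, [/\ 0 < c, 0 < q & forall S : R, 0 <= S ->
     1 - c / (S `^ q + c) <= 2 * \int[lebesgue_measure]_(x in `[0, S]) rho x])
  (hrho_pos : p = 1 -> forall x, 0 < rho x).
Local Notation psi1 := (derive_nneg psi).
Local Notation psi2 := (derive_nneg (derive_nneg psi)).

Let rho_ge0 x : 0 <= rho x. Proof. by case: hrho. Qed.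
Let p_gt0 : 0 < p. Proof. by case/andP: hp. Qed.
Let p_le1 : p <= 1. Proof. by case/andP: hp. Qed.

Variables (T : Type) (U : set_system T) (FU : ProperFilter U).
Variables (m x : T -> R) (d : R).
Hypotheses (m_gt0 : forall k, 0 < m k) (m_cvg : m @ U --> (0 : R))
  (x_cvg : x @ U --> (0 : R)).
Let K k := phi rho (m k) (x k).
Let a k := dtheta rho (x k / m k).
Let b k := 2 * rho (x k / m k) / m k.
Hypotheses (d_cvg : dpen psi p (K k) (a k) @[k --> U] --> d)
  (d_lt : p = 1 -> `|d| < psi1 0).

Let K_gt0 k : 0 < K k. Proof. exact: phi_gt0. Qed.

Let K_cvg : K @ U --> (0 : R).
Proof.
by have := phi_cvg hrho hmoment hrho_cont FU m_gt0 m_cvg x_cvg; rewrite normr0; exact.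
Qed.

Let K_powR_cvg r : 0 < r -> K k `^ r @[k --> U] --> (0 : R).
Proof. by move=> r0; apply: cvg_comp (powR_cvg0 r0); exact: cvg_at_right0. Qed.

Let s_cvg : psi1 (K k `^ p) @[k --> U] --> psi1 0.
Proof.
have c0 : psi1 @ 0^'+ --> psi1 0.
  by apply: derivable_nneg_continuous0; case: hpsi => _ + _; exact.
apply: cvg_comp c0; apply: cvg_at_right0 => [k|]; first by rewrite powR_gt0.
exact: K_powR_cvg.
Qed.

Let s_gt0 k : 0 < psi1 (K k `^ p).
Proof. by apply: hpsi1; exact: powR_ge0. Qed.

(** Solves [dpen] for its last argument. The factor [K ^ (1 - p)] forces [a] to 0 when [p < 1] and
    equals 1 when [p = 1]. *)
Let a_dpen k : dpen psi p (K k) (a k) / (p * psi1 (K k `^ p)) * K k `^ (1 - p) = a k.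
Proof.
have E : K k `^ (p - 1) * K k `^ (1 - p) = 1.
  by rewrite -powRD ?(lt0r_neq0 (K_gt0 k)) ?implybT// addrC subrKA subrr powRr0.
rewrite /dpen -[RHS]mulr1 -[X in _ = _ * X]E; field.
by rewrite (lt0r_neq0 (s_gt0 k)) (lt0r_neq0 p_gt0).
Qed.

Let a_cvg : p < 1 -> a @ U --> (0 : R).
Proof.
move=> p1; rewrite -(funext a_dpen).
rewrite -[X in _ --> X](mulr0 (d / (p * psi1 0))); apply: cvgM; last first.
  by apply: K_powR_cvg; rewrite subr_gt0.
apply: cvgM => //; apply: cvgV.
  by rewrite mulf_neq0 ?(lt0r_neq0 p_gt0)// gt_eqF// hpsi1.
by apply: cvgM => //; exact: cvg_cst.
Qed.

Let a_cvg1 : p = 1 -> a @ U --> d / psi1 0.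
Proof.
move=> p1; rewrite -(funext a_dpen).
have -> : d / psi1 0 = d / (p * psi1 0) * 1 by rewrite p1 mul1r mulr1.
apply: cvgM; last first.
  by rewrite p1 subrr; under eq_fun do rewrite powRr0; exact: cvg_cst.
apply: cvgM => //; apply: cvgV.
  by rewrite mulf_neq0 ?(lt0r_neq0 p_gt0)// gt_eqF// hpsi1.
by apply: cvgM => //; exact: cvg_cst.
Qed.

(** By contraposition: [|a|] is [dtheta] at [|x / m|], and [dtheta] is nondecreasing, so a ratio
    beyond [Y] would give [|a| >= dtheta Y > A]. *)
Let ratio_bound Y A : 0 <= Y -> A < dtheta rho Y -> (\forall k \near U, `|a k| <= A) ->
  \forall k \near U, `|x k / m k| <= Y.
Proof.
move=> Y0 AY; apply: filterS => k ak; rewrite leNgt; apply/negP => Yy.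
have := le_trans (dtheta_homo hrho hrho_cont (ltW Yy)) (ler_norm _).
move=> h; have : `|dtheta rho `|x k / m k| | <= `|a k|.
  have -> : a k = Num.sg (x k / m k) * dtheta rho `|x k / m k| by exact: dtheta_abs.
  rewrite [leRHS]normrM normr_sg.
  have -> : (x k / m k != 0); last by rewrite mul1r.
  by rewrite -normr_gt0 (le_lt_trans Y0).
by move: h ak AY; lra.
Qed.

Let density_near0 : 0 < rho 0 -> exists2 Y, 0 < Y & 0 < rho Y.
Proof.
move=> r0; have : \forall y \near (0 : R), 0 < rho y.
  exact: (cvgr_gt _ (@hrho_cont 0)).
move=> H; have {}H : \forall y \near (0 : R)^'+, 0 < rho y by apply: cvg_within.
near (0 : R)^'+ => Y; exists Y; near: Y => //; exact: nbhs_right_gt.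
Unshelve. all: by end_near. Qed.

(** Otherwise [dtheta y <= 2 * rho 0 * y = 0] for all [y >= 0], although [dtheta] tends to 1. *)
Let density0_gt0 : 0 < rho 0.
Proof.
rewrite lt_def rho_ge0 andbT; apply/eqP => r0.
have : \forall y \near +oo, 1 / 2 <= dtheta rho y.
  by apply: (cvgr_ge _ (dtheta_cvg1 hrho hrho_even hrho_cont hrho_tail)); lra.
move=> H; near +oo_R => y.
have : dtheta rho y <= 2 * rho 0 * y.
  by apply: dtheta_le_linear.
have : 1 / 2 <= dtheta rho y by near: y.
rewrite r0; lra.
Unshelve. all: by end_near. Qed.

(* The bound [(1 - p) a ^ 2 <= rho Y * theta 0] makes the concave part of
   [K `^ p] negligible against its [b]-part. *)
Let ratio_bounded : exists2 Y, 0 < rho Y &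
  (\forall k \near U, `|x k / m k| <= Y) /\
  (\forall k \near U, (1 - p) * a k ^+ 2 <= rho Y * theta rho 0).
Proof.
have th0 : 0 < theta rho 0 by apply: theta0_gt0.
have [p1|p1] := ltP p 1.
  have [Y Y0 rY] := density_near0 density0_gt0.
  have tY : 0 < dtheta rho Y.
    have [c /andP[c0 cY]] := MVT_everywhere (is_derive_dtheta hrho hrho_cont) (ltW Y0).
    rewrite dtheta0// !subr0 => ->; rewrite !mulr_gt0//.
    by apply: lt_le_trans rY _; exact: hrho_decr.
  exists Y => //; split.
    apply: (@ratio_bound _ (dtheta rho Y / 2)); [exact: ltW|by move: tY; lra|].
    apply: (cvgr_norm_le _ (a_cvg p1)); rewrite normr0; by move: tY; lra.
  have A2 : (1 - p) * a k ^+ 2 @[k --> U] --> (0 : R).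
    rewrite -[X in _ --> X](mulr0 (1 - p)); apply: cvgM; first exact: cvg_cst.
    by have := cvgM (a_cvg p1) (a_cvg p1); rewrite mulr0; exact.
  by apply: (cvgr_le _ A2); rewrite mulr_gt0.
have {p1} p1 : p = 1 by apply/eqP; rewrite eq_le p_le1.
have s0 : 0 < psi1 0 by apply: hpsi1.
(* The midpoint between the limit of [|a|], which is less than 1, and the limit 1 of [dtheta]: it is
   eventually above the former and exceeded by the latter. *)
pose A := (`|d / psi1 0| + 1) / 2.
have dA : `|d / psi1 0| < 1.
  by rewrite normrM normfV (gtr0_norm s0) ltr_pdivrMr// mul1r; exact: d_lt.
have [Y Y0 AY] : exists2 Y, 0 <= Y & A < dtheta rho Y.
  have H : \forall y \near +oo, A < dtheta rho y.
    apply: (cvgr_gt _ (dtheta_cvg1 hrho hrho_even hrho_cont hrho_tail)).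
    by rewrite /A; lra.
  near +oo_R => y; exists y; near: y => //.
  by apply: nbhs_pinfty_ge; rewrite num_real.
exists Y; first exact: hrho_pos.
split.
  apply: (ratio_bound Y0 AY).
  by apply: (cvgr_norm_le _ (a_cvg1 p1)); rewrite /A; lra.
by near=> k; rewrite p1 subrr mul0r mulr_ge0// ltW.
Unshelve. all: by end_near. Qed.

(** The [psi''] term is bounded below by [- D], and the [psi'] term is at least [c * p * B / K],
    where [K] tends to 0. *)
Lemma ddpen_cvgy : ddpen psi p (K k) (a k) (b k) @[k --> U] --> +oo.
Proof.
have [Y rY [yY aY]] := ratio_bounded.
have th0 : 0 < theta rho 0 by apply: theta0_gt0.
have s0 : 0 < psi1 0 by apply: hpsi1.
set B := rho Y * theta rho 0 in aY.
have B0 : 0 < B by rewrite mulr_gt0.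
pose C := `|d| + 1.
have C0 : 0 <= C by rewrite addr_ge0.
have dC : \forall k \near U, `|dpen psi p (K k) (a k)| <= C.
  by apply: (cvgr_norm_le _ d_cvg); rewrite ltrDl.
pose c := psi1 0 / 2.
have c0 : 0 < c by rewrite divr_gt0.
have sc : \forall k \near U, c <= psi1 (K k `^ p).
  by apply: (cvgr_ge _ s_cvg); rewrite /c; lra.
pose D := beta * (C / c) ^+ 2.
have D0 : 0 <= D by rewrite mulr_ge0 ?sqr_ge0 ?ltW.
apply/cvgryPge => M; near=> k.
have mk := m_gt0 k; have Kk := K_gt0 k; have sk := s_gt0 k.
have H1 : - D <= psi2 (K k `^ p) * (p * K k `^ (p - 1) * a k) ^+ 2.
  (* [K ^ (p - 1)] may be unbounded, but this product is the convergent first derivative divided by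
     [psi'], which is at least [c]. *)
  have -> : p * K k `^ (p - 1) * a k = dpen psi p (K k) (a k) / psi1 (K k `^ p).
    by rewrite /dpen; field; exact: lt0r_neq0.
  have /andP[h1 h2] := hpsi2 (powR_ge0 (K k) p).
  set q := _ / _.
  have q2 : q ^+ 2 <= (C / c) ^+ 2.
    have qC : `|q| <= C / c.
      rewrite normrM normfV (gtr0_norm sk); apply: ler_pM => //.
      - by rewrite invr_ge0 ltW.
      - by near: k.
      - by rewrite lef_pV2 ?posrE//; near: k.
    rewrite -(real_normK (num_real q)); apply: lerXn2r => //.
    by rewrite nnegrE divr_ge0// ltW.
  have : beta * q ^+ 2 <= D := ler_wpM2l (ltW hbeta) q2.
  have : - beta * q ^+ 2 <= psi2 (K k `^ p) * q ^+ 2.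
    by apply: ler_wpM2r => //; exact: sqr_ge0.
  by lra.
(* The parameter cancels: [K * b] is twice [rho * theta] at [x / m], bounded below by [|x / m| <= Y]
   and by the minimum of [theta] at 0. *)
have Kb : 2 * B <= K k * b k.
  rewrite /K /b phi_theta// /B.
  rewrite [leRHS](_ : _ = 2 * (rho (x k / m k) * theta rho (x k / m k))); last first.
    by field; exact: lt0r_neq0.
  apply: ler_wpM2l => //; apply: ler_pM => //; [exact: ltW| |exact: theta_min].
  rewrite [leRHS]density_abs//; apply: hrho_decr => //; by near: k.
have K1 : K k `^ (p - 1 - 1) = K k `^ (p - 1) / K k.
  by rewrite powRD ?(lt0r_neq0 Kk) ?implybT// powR_inv1// ltW.
(* The concave part costs at most one of the two copies of [B] provided by [Kb]. *)
have H2 : B / K k <= (p - 1) * (a k ^+ 2 / K k) + b k.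
  have aB : (1 - p) * a k ^+ 2 <= B by near: k.
  rewrite ler_pdivrMr// [leRHS](_ : _ = (p - 1) * a k ^+ 2 + K k * b k); last first.
    by field; exact: lt0r_neq0.
  by move: Kb aB; lra.
have H3 : 1 <= K k `^ (p - 1).
  have : K k <= 1 by near: k; apply: (cvgr_le _ K_cvg).
  move=> K1'; rewrite -[leLHS](powRr0 (K k)).
  by apply: ger_powR; rewrite ?Kk//= subr_le0.
have -> : ddpen psi p (K k) (a k) (b k) =
   psi2 (K k `^ p) * (p * K k `^ (p - 1) * a k) ^+ 2 +
   psi1 (K k `^ p) * (p * (K k `^ (p - 1) * ((p - 1) * (a k ^+ 2 / K k) + b k))).
  by rewrite /ddpen K1; field; exact: lt0r_neq0.
have BK : 0 <= B / K k by rewrite divr_ge0// ltW.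
apply: (@le_trans _ _ (- D + c * (p * (1 * (B / K k))))); last first.
  apply: lerD => //; apply: ler_pM => //.
  - exact: ltW.
  - by rewrite mulr_ge0 ?mul1r// ltW.
  - by near: k.
  - by apply: ler_wpM2l; [exact: ltW|apply: ler_pM].
rewrite addrC lerBrDr mul1r !mulrA ler_pdivlMr//.
(* It remains to make [K] small compared with [c * p * B / (|M + D| + 1)]. *)
apply: (@le_trans _ _ ((`|M + D| + 1) * K k)).
  by apply: ler_wpM2r; [exact: ltW|rewrite (le_trans (ler_norm _))// lerDl].
rewrite -ler_pdivlMl ?ltr_wpDl//.
near: k; apply: (cvgr_le _ K_cvg).
by rewrite mulr_gt0 ?invr_gt0 ?ltr_wpDl// !mulr_gt0.
Unshelve. all: by end_near. Qed.

End Blowup.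

(** * Gradients and Hessians *)

Section Directional.
Variable R : realType.

(** Reduces directional derivatives to one real variable, where the chain rules above apply. *)
Lemma is_derive_line (m : nat) (h : 'rV[R]_m -> R) (x v : 'rV[R]_m) (l : R) :
  is_derive x v h l <-> is_derive (0 : R) 1 (fun t : R => h (t *: v + x)) l.
Proof.
have E : (fun t : R =>
      t^-1 *: (((fun t : R => h (t *: v + x)) \o shift 0) (t *: (1 : R)) - h (0 *: v + x)))
    = (fun t => t^-1 *: ((h \o shift x) (t *: v) - h x)).
  by apply/funext => t; rewrite /= scale0r add0r addr0 /GRing.scale /= mulr1.
by split=> -[d <-]; apply: DeriveDef; move: d; rewrite /derivable /derive E.
Qed.

Lemma is_derive_coord (m : nat) (u : R -> R) (l : R) (x v : 'rV[R]_m) (j : 'I_m) :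
  is_derive (x 0 j) 1 u l -> is_derive x v (fun w : 'rV[R]_m => u (w 0 j)) (l * v 0 j).
Proof.
move=> du; apply/is_derive_line.
have D : is_derive (0 : R) 1 (fun t : R => v 0 j * t + x 0 j) (v 0 j * 1 + 0).
  exact: (is_deriveD (is_deriveZ (v 0 j) (is_derive_id (0 : R) 1))
    (is_derive_cst (x 0 j) (0 : R) 1)).
have -> : (fun t : R => u ((t *: v + x) 0 j)) = u \o (fun t : R => v 0 j * t + x 0 j).
  by apply/funext => t; rewrite /= !mxE mulrC.
have -> : l * v 0 j = l * (v 0 j * 1 + 0) by rewrite mulr1 addr0.
by apply: is_derive1_comp D; rewrite mulr0 add0r.
Qed.

Lemma is_derive_lsubmx (n1 n2 : nat) (h : 'rV[R]_n1 -> R) (l : R)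
    (z v : 'rV[R]_(n1 + n2)) :
  is_derive (lsubmx z) (lsubmx v) h l ->
  is_derive z v (fun z => h (lsubmx z)) l.
Proof.
move=> /is_derive_line dh; apply/is_derive_line; move: dh.
by congr is_derive; apply/funext => t; rewrite linearD linearZ.
Qed.

Lemma is_derive_rsubmx (n1 n2 : nat) (h : 'rV[R]_n2 -> R) (l : R)
    (z v : 'rV[R]_(n1 + n2)) :
  is_derive (rsubmx z) (rsubmx v) h l ->
  is_derive z v (fun z => h (rsubmx z)) l.
Proof.
move=> /is_derive_line dh; apply/is_derive_line; move: dh.
by congr is_derive; apply/funext => t; rewrite linearD linearZ.
Qed.

Lemma is_derive_big (m n : nat) (h : 'I_n -> 'rV[R]_m -> R) (l : 'I_n -> R)
    (x v : 'rV[R]_m) :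
  (forall i, is_derive x v (h i) (l i)) ->
  is_derive x v (fun w => \sum_(i < n) h i w) (\sum_(i < n) l i).
Proof.
move=> dh; rewrite (_ : (fun w => _) = \sum_(i < n) h i); first exact: is_derive_sum.
by apply/funext => w; rewrite fct_sumE.
Qed.

Lemma partialE (m : nat) (h : 'rV[R]_m -> R) (i : 'I_m) x l :
  is_derive x (unitv R i) h l -> partial h i x = l.
Proof. by case. Qed.

Lemma unitvE (m : nat) (i j : 'I_m) : unitv R i 0 j = (i == j)%:R.
Proof. by rewrite mxE eqxx eq_sym. Qed.

Lemma C1_is_derive (m : nat) (h : 'rV[R]_m -> R) (x v : 'rV[R]_m) :
  C1 h -> is_derive x v h ('D_v h x).
Proof. by move=> [dh _]; exact/derivableP/diff_derivable. Qed.

Lemma C1_partial_continuous (m : nat) (h : 'rV[R]_m -> R) (i : 'I_m) :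
  C1 h -> continuous (partial h i).
Proof.
move=> [_ ch] x; rewrite (_ : partial h i = (fun w => (grad h w) 0 i)).
  exact: (cvg_comp _ _ (ch x) (@coord_continuous _ _ _ 0 i (grad h x))).
by apply/funext => w; rewrite mxE.
Qed.

Lemma C2_hess_continuous (m : nat) (h : 'rV[R]_m -> R) (i j : 'I_m) :
  C2 h -> continuous (partial (partial h j) i).
Proof. by move=> [_ ch]; apply: C1_partial_continuous. Qed.

End Directional.

(** * Derivatives of [G] and of the functions [Psi_j] *)

Section Lagrangian.
Variables (R : realType) (n r : nat) (g : 'rV[R]_n -> R) (Rs : 'I_r -> 'rV[R]_n -> R).
Hypotheses (hg : C2 g) (hRs : forall i, C2 (Rs i)).

Lemma partial_G (lb : 'rV[R]_r) (j : 'I_n) :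
  partial (G g Rs ^~ lb) j =
  (fun w => partial g j w + \sum_(k < r) lb 0 k * partial (Rs k) j w).
Proof.
apply/funext => w; apply: partialE.
apply: is_deriveD; first by apply: C1_is_derive; case: hg.
apply: is_derive_big => k; apply: is_deriveZ.
by apply: C1_is_derive; case: (hRs k).
Qed.

Lemma hess_G (lb : 'rV[R]_r) (i j : 'I_n) (w : 'rV[R]_n) :
  hess (G g Rs ^~ lb) w i j =
  partial (partial g j) i w + \sum_(k < r) lb 0 k * partial (partial (Rs k) j) i w.
Proof.
rewrite mxE partial_G; apply: partialE.
apply: is_deriveD; first by apply: C1_is_derive; case: hg.
apply: is_derive_big => k; apply: is_deriveZ.
by apply: C1_is_derive; case: (hRs k).
Qed.

Section Psi.
Variables (psi : R -> R) (p : R).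
Hypotheses (hpsi : C2_nneg psi).

(** The limit penalty is the same expression [dpen], with [|x|] and its derivative [sgn x] in place
    of [phi] and its derivative. *)
Lemma Phi_dpen (j : 'I_n) (w : 'rV[R]_n) (l : 'rV[R]_r.+1) :
  Phi g Rs psi p j w l =
  partial g j w + \sum_(k < r) l 0 (lift ord0 k) * partial (Rs k) j w
  + l 0 ord0 * dpen psi p `|w 0 j| (Num.sg (w 0 j)).
Proof.
rewrite /Phi partial_G /dpen; congr (_ + _ + _); last by ring.
by apply: eq_bigr => k _; rewrite mxE.
Qed.

Lemma is_derive_norm (x : R) : x != 0 -> is_derive x 1 (fun y : R => `|y|) (Num.sg x).
Proof.
move=> x0; have [xp|xn|/eqP] := ltrgt0P x; last by rewrite (negbTE x0).
  rewrite gtr0_sg//; apply: near_eq_is_derive (is_derive_id x (1 : R)).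
  by near=> y; rewrite gtr0_norm//; near: y; exact: lt_nbhsr.
rewrite ltr0_sg//; apply: near_eq_is_derive (is_deriveNid x (1 : R)).
by near=> y; rewrite ltr0_norm//; near: y; exact: lt_nbhsl.
Unshelve. all: by end_near. Qed.

Lemma is_derive_sg (x : R) : x != 0 -> is_derive x 1 (Num.sg : R -> R) 0.
Proof.
move=> x0; have [xp|xn|/eqP] := ltrgt0P x; last by rewrite (negbTE x0).
  apply: near_eq_is_derive (is_derive_cst (1 : R) x 1).
  by near=> y; rewrite gtr0_sg//; near: y; exact: lt_nbhsr.
apply: near_eq_is_derive (is_derive_cst (-1 : R) x 1).
by near=> y; rewrite ltr0_sg//; near: y; exact: lt_nbhsl.
Unshelve. all: by end_near. Qed.

(** The last argument of [ddpen] is 0 because the sign is locally constant away from 0. *)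
Lemma is_derive_Psi (w' w : 'rV[R]_n) (l : 'rV[R]_r.+1) (j : 'I_n)
    (v : 'rV[R]_(n + r.+1)) :
  w' 0 j != 0 -> w 0 j != 0 ->
  is_derive (row_mx w l) v (Psi g Rs psi p w' j)
   ('D_(lsubmx v) (partial g j) w
    + \sum_(k < r) (l 0 (lift ord0 k) * 'D_(lsubmx v) (partial (Rs k) j) w
                    + partial (Rs k) j w * rsubmx v 0 (lift ord0 k))
    + (l 0 ord0 * (ddpen psi p `|w 0 j| (Num.sg (w 0 j)) 0 * lsubmx v 0 j)
       + dpen psi p `|w 0 j| (Num.sg (w 0 j)) * rsubmx v 0 ord0)).
Proof.
move=> w'j wj.
have -> : Psi g Rs psi p w' j = (fun z : 'rV[R]_(n + r.+1) =>
    partial g j (lsubmx z)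
    + \sum_(k < r) rsubmx z 0 (lift ord0 k) * partial (Rs k) j (lsubmx z)
    + rsubmx z 0 ord0 * dpen psi p `|lsubmx z 0 j| (Num.sg (lsubmx z 0 j))).
  by apply/funext => z; rewrite /Psi (negbTE w'j) Phi_dpen.
have dl k : is_derive (row_mx w l) v
    (fun z : 'rV[R]_(n + r.+1) => rsubmx z 0 k) (rsubmx v 0 k).
  apply: (is_derive_rsubmx (h := fun y => y 0 k)).
  by rewrite -[X in is_derive _ _ _ X]mul1r; apply: (is_derive_coord (u := id)).
apply: is_deriveD; first apply: is_deriveD.
- apply: is_derive_lsubmx; rewrite row_mxKl.
  by apply: C1_is_derive; case: hg.
- apply: is_derive_big => k.
  have dR : is_derive (row_mx w l) v
      (fun z : 'rV[R]_(n + r.+1) => partial (Rs k) j (lsubmx z))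
      ('D_(lsubmx v) (partial (Rs k) j) w).
    apply: is_derive_lsubmx; rewrite row_mxKl.
    by apply: C1_is_derive; case: (hRs k).
  by have := is_deriveM (dl (lift ord0 k)) dR; rewrite row_mxKl row_mxKr; apply.
- have dpenw : is_derive (row_mx w l) v (fun z : 'rV[R]_(n + r.+1) =>
        dpen psi p `|lsubmx z 0 j| (Num.sg (lsubmx z 0 j)))
      (ddpen psi p `|w 0 j| (Num.sg (w 0 j)) 0 * lsubmx v 0 j).
    apply: (is_derive_lsubmx (h := fun w => dpen psi p `|w 0 j| (Num.sg (w 0 j)))).
    rewrite row_mxKl.
    apply: (is_derive_coord (u := fun y => dpen psi p `|y| (Num.sg y))).
    apply: (@is_derive_dpen _ _ p hpsi (fun y => `|y|) Num.sg) => //.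
    + by rewrite normr_gt0.
    + exact: is_derive_norm.
    + exact: is_derive_sg.
  by have := is_deriveM (dl ord0) dpenw; rewrite row_mxKl row_mxKr; apply.
Qed.

(** This is column [j] of the limit of the matrix in the first KKT equation. The [lambda] components
    computed next are the limit coefficients of the second and third ones. *)
Lemma grad_Psi_lshift (w : 'rV[R]_n) (l : 'rV[R]_r.+1) (i j : 'I_n) : w 0 j != 0 ->
  grad (Psi g Rs psi p w j) (row_mx w l) 0 (lshift r.+1 i) =
  hess (G g Rs ^~ (lbar l)) w i j
  + l 0 ord0 * ((i == j)%:R * ddpen psi p `|w 0 j| (Num.sg (w 0 j)) 0).
Proof.
move=> wj; rewrite mxE (partialE (is_derive_Psi l _ wj wj)) hess_G.
have -> : lsubmx (unitv R (lshift r.+1 i)) = unitv R i.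
  by apply/rowP => k; rewrite mxE !unitvE (inj_eq (@lshift_inj _ _)).
have -> : rsubmx (unitv R (lshift r.+1 i)) = 0.
  by apply/rowP => k; rewrite mxE unitvE mxE eq_lrshift.
rewrite unitvE mxE mulr0 addr0 [_ * (i == j)%:R]mulrC; congr (_ + _ + _).
by apply: eq_bigr => k _; rewrite !mxE mulr0 addr0.
Qed.

Lemma grad_Psi_rshift0 (w : 'rV[R]_n) (l : 'rV[R]_r.+1) (j : 'I_n) : w 0 j != 0 ->
  grad (Psi g Rs psi p w j) (row_mx w l) 0 (rshift n ord0) =
  dpen psi p `|w 0 j| (Num.sg (w 0 j)).
Proof.
move=> wj; rewrite mxE (partialE (is_derive_Psi l _ wj wj)).
have -> : lsubmx (unitv R (rshift n (ord0 : 'I_r.+1))) = 0.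
  by apply/rowP => k; rewrite mxE unitvE mxE eq_rlshift.
have E k : rsubmx (unitv R (rshift n (ord0 : 'I_r.+1))) 0 k = (ord0 == k)%:R.
  by rewrite mxE unitvE (inj_eq (@rshift_inj _ _)).
rewrite !derive0 add0r big1 ?add0r => [|k _]; last by rewrite derive0 E !mulr0 addr0.
by rewrite E mxE !mulr0 add0r mulr1.
Qed.

Lemma grad_Psi_rshift (w : 'rV[R]_n) (l : 'rV[R]_r.+1) (j : 'I_n) (k : 'I_r) :
  w 0 j != 0 ->
  grad (Psi g Rs psi p w j) (row_mx w l) 0 (rshift n (lift ord0 k)) =
  partial (Rs k) j w.
Proof.
move=> wj; rewrite mxE (partialE (is_derive_Psi l _ wj wj)).
have -> : lsubmx (unitv R (rshift n (lift ord0 k))) = 0.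
  by apply/rowP => i; rewrite mxE unitvE mxE eq_rlshift.
have E i : rsubmx (unitv R (rshift n (lift ord0 k))) 0 i = (lift ord0 k == i)%:R.
  by rewrite mxE unitvE (inj_eq (@rshift_inj _ _)).
rewrite !derive0 add0r (bigD1 k)//= big1 => [|i ik]; last first.
  by rewrite derive0 E (inj_eq lift_inj) eq_sym (negbTE ik) !mulr0 addr0.
by rewrite derive0 !E eqxx mxE !mulr0 !addr0 add0r mulr1.
Qed.

Lemma grad_Psi_active (w : 'rV[R]_n) (z : 'rV[R]_(n + r.+1)) (j : 'I_n) : w 0 j = 0 ->
  grad (Psi g Rs psi p w j) z = unitv R (lshift r.+1 j).
Proof.
move=> wj; apply/rowP => i; rewrite mxE unitvE.
have -> : Psi g Rs psi p w j = (fun z : 'rV[R]_(n + r.+1) => z 0 (lshift r.+1 j)).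
  by apply/funext => y; rewrite /Psi wj eqxx mxE.
apply: partialE; rewrite eq_sym -unitvE -[X in is_derive _ _ _ X]mul1r.
exact: (is_derive_coord (u := id)).
Qed.

End Psi.
End Lagrangian.

(** * Gradient and diagonal Hessian of the smoothed penalty *)

Section SmoothedPenalty.
Variables (R : realType) (psi rho : R -> R) (p : R).
Hypotheses (hpsi : C2_nneg psi)
  (hrho : prob_density rho) (hmoment : finite_first_moment rho)
  (hrho_even : forall x, rho x = rho (- x)) (hrho_cont : continuous rho)
  (hrho_decr : forall x y, 0 <= x -> x <= y -> rho y <= rho x).

Lemma partial_varphi n (m : R) (j : 'I_n) : 0 < m ->
  partial (varphi psi rho p m) j =
  (fun w => dpen psi p (phi rho m (w 0 j)) (dtheta rho (w 0 j / m))).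
Proof.
move=> m0; apply/funext => w; apply: partialE.
have D (i : 'I_n) : is_derive w (unitv R j)
    (fun w : 'rV[R]_n => psi (phi rho m (w 0 i) `^ p))
    (dpen psi p (phi rho m (w 0 i)) (dtheta rho (w 0 i / m)) * unitv R j 0 i).
  apply: (is_derive_coord (u := fun y => psi (phi rho m y `^ p))).
  by apply: is_derive_pen => //; [exact: phi_gt0|exact: is_derive_phi].
have := is_derive_big D; rewrite (bigD1 j)//= big1 => [|i ij]; last first.
  by rewrite unitvE eq_sym (negbTE ij) mulr0.
by rewrite unitvE eqxx addr0 mulr1.
Qed.

Lemma hess_varphi n (m : R) (i j : 'I_n) (w : 'rV[R]_n) : 0 < m ->
  hess (varphi psi rho p m) w i j = (i == j)%:R *
  ddpen psi p (phi rho m (w 0 j)) (dtheta rho (w 0 j / m))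
    (2 * rho (w 0 j / m) / m).
Proof.
move=> m0; rewrite mxE partial_varphi//; apply: partialE.
rewrite -unitvE mulrC.
apply: (is_derive_coord (u := fun y => dpen psi p (phi rho m y) (dtheta rho (y / m)))).
apply: is_derive_dpen => //; [exact: phi_gt0|exact: is_derive_phi|].
exact: is_derive_dphi.
Qed.

End SmoothedPenalty.

(** * Limits of normalized multipliers *)

(** The combination [c *m M] equals [(0, e)]. Pairing it with [d] makes a sum of nonnegative terms
    [e i * d i] vanish, so [e = 0]; then [row_free] gives [c = 0], and [c] agrees with [z] outside
    [I]. *)
Lemma MFCQ_multipliers_eq0 (R : realType) (n r : nat) (M : 'M[R]_(n, n + r))
    (I : pred 'I_n) (act : pred 'I_r) (z : 'I_n -> R) (e : 'I_r -> R)
    (d : 'rV[R]_(n + r)) :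
  row_free M -> (forall j, I j -> row j M = unitv R (lshift r j)) ->
  (forall j, \sum_l M j l * d 0 l = 0) -> (forall i, act i -> 0 < d 0 (rshift n i)) ->
  (forall j, I j -> z j = 0) ->
  (forall i, ~~ I i -> \sum_j z j * M j (lshift r i) = 0) ->
  (forall i, \sum_j z j * M j (rshift n i) = e i) ->
  (forall i, 0 <= e i) -> (forall i, ~~ act i -> e i = 0) ->
  (forall j, z j = 0) /\ (forall i, e i = 0).
Proof.
move=> freeM MI Md dpos zI zM zMe e0 eact.
(* [c] corrects [z] on [I] so as to cancel the [w]-components of [z *m M]. *)
pose c : 'rV[R]_n := \row_j (if I j then - \sum_k z k * M k (lshift r j) else z j).
have cMl l : (c *m M) 0 l =
    \sum_j z j * M j l + \sum_(j | I j) c 0 j * (lshift r j == l)%:R.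
  rewrite mxE [X in _ + X]big_mkcond -big_split; apply: eq_bigr => j _ /=.
  rewrite mxE; have [Ij|] := boolP (I j); last by rewrite addr0.
  rewrite zI// mul0r add0r; congr (_ * _).
  by have := MI _ Ij => /rowP/(_ l); rewrite mxE unitvE.
have cMr i : (c *m M) 0 (rshift n i) = e i.
  by rewrite cMl zMe big1 ?addr0// => j _; rewrite eq_lrshift mulr0.
have cMl0 i : (c *m M) 0 (lshift r i) = 0.
  rewrite cMl; under [X in _ + X]eq_bigr => j _ do rewrite (inj_eq (@lshift_inj _ _)).
  have [Ii|Ii] := boolP (I i).
    have -> : \sum_(j | I j) c 0 j * (j == i)%:R = c 0 i.
      rewrite (bigD1 i)//= eqxx mulr1 big1 ?addr0// => j /andP[_ /negbTE ->].
      by rewrite mulr0.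
    by rewrite mxE Ii subrr.
  rewrite zM// add0r big1// => j Ij; case: eqP => [E|_]; last by rewrite mulr0.
  by move: Ii; rewrite -E Ij.
have cMd : \sum_i e i * d 0 (rshift n i) = 0.
  have : \sum_l (c *m M) 0 l * d 0 l = 0.
    under eq_bigr => l _ do rewrite mxE mulr_suml.
    rewrite exchange_big big1//= => j _.
    by under eq_bigr => l _ do rewrite -mulrA; rewrite -mulr_sumr Md mulr0.
  rewrite big_split_ord /= big1 => [|i _]; last by rewrite cMl0 mul0r.
  by rewrite add0r; under eq_bigr do rewrite cMr.
have ed_ge0 i : true -> 0 <= e i * d 0 (rshift n i).
  move=> _; have [/dpos/ltW ai|/eact ->] := boolP (act i); last by rewrite mul0r.
  exact: mulr_ge0.
have e_eq0 i : e i = 0.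
  have [ai|/eact//] := boolP (act i).
  have /eqP := psumr_eq0P ed_ge0 cMd (i := i) isT.
  by rewrite mulf_eq0 (gt_eqF (dpos _ ai)) orbF => /eqP.
split=> // j; have [/zI//|Ij] := boolP (I j).
have c0 : c = 0.
  apply: (row_free_inj freeM); rewrite mul0mx; apply/rowP => l; rewrite [RHS]mxE.
  by case: (split_ordP l) => i ->; rewrite ?cMl0 ?cMr ?e_eq0.
by have /rowP/(_ j) := c0; rewrite !mxE (negbTE Ij).
Qed.

(** Compactness gives a cluster point [l]. For a neighbourhood [B] of [l], the ultrafilter contains
    the preimage of [B] or its complement, and clustering excludes the complement. *)
Lemma ultra_cvg_compact (T : Type) (X : topologicalType) (U : set_system T)
    (u : T -> X) (A : set X) : UltraFilter U -> compact A -> (forall k, A (u k)) ->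
  exists2 l, A l & u @ U --> l.
Proof.
move=> UU cA Au.
have [l [Al ul]] := cA (u @ U) _ (filterS (fun k _ => Au k) filterT).
exists l => // B Bl; have [//|UB] := in_ultra_setVsetC (u @^-1` B) UU.
by have [y []] := ul (~` B) B UB Bl.
Qed.

(** * Componentwise bounds from the approximate KKT conditions *)

Section KKT.
Variables (R : realType) (n r : nat) (f g : 'rV[R]_n -> R) (Rs : 'I_r -> 'rV[R]_n -> R).
Variables (psi rho : R -> R) (p eps m ehat : R).
Variables (w zeta : 'rV[R]_n) (lambda eta : 'rV[R]_r.+1).
Hypothesis kkt : approx_KKT f g Rs psi rho p eps m ehat w lambda zeta eta.

(** Each residual component is bounded by the Euclidean norm of the whole residual vector. *)
Lemma approx_KKT_bounds :
  [/\ forall i, `|partial f i w + \sum_j (hess (G g Rs ^~ (lbar lambda)) w i j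
         + lambda 0 ord0 * hess (varphi psi rho p m) w i j) * zeta 0 j| <= ehat,
      `|\sum_j partial (varphi psi rho p m) j w * zeta 0 j - eta 0 ord0| <= ehat,
      forall k, `|\sum_j partial (Rs k) j w * zeta 0 j - eta 0 (lift ord0 k)| <= ehat,
      forall i, `|partial (G g Rs ^~ (lbar lambda)) i w
         + lambda 0 ord0 * partial (varphi psi rho p m) i w| <= ehat &
      [/\ forall i, 0 <= lambda 0 i - eps * (i == ord0)%:R, forall i, 0 <= eta 0 i &
        `|\sum_i (lambda 0 i - eps * (i == ord0)%:R) * eta 0 i| <= ehat]].
Proof.
case: kkt => [e1 [e2 [e3 [e4 [e5 [eE [k1 k2 k3 k4 [k5 k6 k7]]]]]]]].
have sq q (e : 'rV[R]_q) : 0 <= sqnorm e.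
  by apply: sumr_ge0 => i _; rewrite -expr2 sqr_ge0.
have sqi q (e : 'rV[R]_q) i : e 0 i ^+ 2 <= sqnorm e.
  rewrite /sqnorm /dotp (bigD1 i)//= -expr2 lerDl; apply: sumr_ge0 => j _.
  by rewrite -expr2 sqr_ge0.
have S x : x ^+ 2 <= sqnorm e1 + e2 ^+ 2 + sqnorm e3 + sqnorm e4 + e5 ^+ 2 ->
    `|x| <= ehat.
  move=> h; apply: le_trans eE.
  by rewrite -sqrtr_sqr ler_sqrt// (le_trans _ h)// sqr_ge0.
have := (sq _ e1, sq _ e3, sq _ e4, sqr_ge0 e2, sqr_ge0 e5) => -[[[[s1 s3] s4] s2] s5].
have eps1 i : eps_e1 r eps 0 i = eps * (i == ord0)%:R.
  by rewrite /eps_e1 mxE unitvE eq_sym.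
split.
- move=> i; rewrite [X in `|X|](_ : _ = e1 0 i).
    by apply: S; have := sqi _ e1 i; lra.
  rewrite -k1 !mxE; congr (_ + _); apply: eq_bigr => j _.
  by rewrite !mxE.
- rewrite [X in `|X|](_ : _ = e2); first by apply: S; lra.
  by rewrite -k2; congr (_ - _); apply: eq_bigr => j _; rewrite mxE.
- move=> k; rewrite [X in `|X|](_ : _ = e3 0 k).
    by apply: S; have := sqi _ e3 k; lra.
  by rewrite -k3; congr (_ - _); apply: eq_bigr => j _; rewrite mxE.
- move=> i; rewrite [X in `|X|](_ : _ = e4 0 i).
    by apply: S; have := sqi _ e4 i; lra.
  by rewrite -k4 !mxE.
split=> //.
- by move=> i; have := k5 i; rewrite !mxE eqxx /=.
- rewrite [X in `|X|](_ : _ = e5); first by apply: S; lra.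
  by rewrite -k7; apply: eq_bigr => i _; rewrite !mxE eqxx /=.
Qed.

End KKT.

Lemma cvg_bigsum (R : realType) (T : Type) (U : set_system T) (FU : Filter U) (n : nat)
    (u : 'I_n -> T -> R) (l : 'I_n -> R) : (forall i, u i k @[k --> U] --> l i) ->
  \sum_(i < n) u i k @[k --> U] --> \sum_(i < n) l i.
Proof.
move=> ul; rewrite (_ : (fun k => _) = \sum_(i < n) u i).
  by elim/big_ind2 : _ => // [|a b c d]; [exact: cvg_cst|exact: cvgD].
by apply/funext => k; rewrite fct_sumE.
Qed.

(** * Limit equations along an ultrafilter *)

Section Normalized.
Variables (R : realType) (n r : nat) (f g : 'rV[R]_n -> R) (Rs : 'I_r -> 'rV[R]_n -> R)
  (psi rho : R -> R) (p eps beta : R).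
Hypotheses (hf : C1 f) (hg : C2 g) (hRs : forall i, C2 (Rs i))
  (hp : 0 < p <= 1) (heps : 0 < eps) (hbeta : 0 < beta) (hpsi : C2_nneg psi)
  (hpsi1 : forall t, 0 <= t -> 0 < derive_nneg psi t)
  (hpsi2 : forall t, 0 <= t -> - beta <= derive_nneg (derive_nneg psi) t <= 0)
  (hrho : prob_density rho) (hmoment : finite_first_moment rho)
  (hrho_even : forall x, rho x = rho (- x)) (hrho_cont : continuous rho)
  (hrho_decr : forall x y, 0 <= x -> x <= y -> rho y <= rho x)
  (hrho_tail : exists c q : R, [/\ 0 < c, 0 < q & forall S : R, 0 <= S ->
     1 - c / (S `^ q + c) <= 2 * \int[lebesgue_measure]_(x in `[0, S]) rho x])
  (hrho_pos : p = 1 -> forall x, 0 < rho x).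
Variables (T : Type) (U : set_system T) (UU : UltraFilter U) (m e N : T -> R)
  (w z : T -> 'rV[R]_n) (l h : T -> 'rV[R]_r.+1) (w0 : 'rV[R]_n) (l0 : 'rV[R]_r.+1).
Hypotheses
  (kkt : forall k,
     approx_KKT f g Rs psi rho p eps (m k) (e k) (w k) (l k) (z k) (h k))
  (m_gt0 : forall k, 0 < m k) (m_cvg : m @ U --> (0 : R)) (e_cvg : e @ U --> (0 : R))
  (w_cvg : w @ U --> w0) (l_cvg : l @ U --> l0)
  (N_gt0 : forall k, 0 < N k) (N_cvg : N @ U --> +oo)
  (zN : forall k i, `|z k 0 i| <= N k) (hN : forall k i, `|h k 0 i| <= N k)
  (mfcq : MFCQ g Rs psi p eps w0 l0)
  (strict : p = 1 -> forall i : 'I_n, w0 0 i = 0 ->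
     `|partial (G g Rs ^~ (lbar l0)) i w0| < l0 0 ord0 * derive_nneg psi 0).

Let dG i k := partial (G g Rs ^~ (lbar (l k))) i (w k).
Let ddG i j k := hess (G g Rs ^~ (lbar (l k))) (w k) i j.
Let K j k := phi rho (m k) (w k 0 j).
Let a j k := dtheta rho (w k 0 j / m k).
Let b j k := 2 * rho (w k 0 j / m k) / m k.
Let dP j k := dpen psi p (K j k) (a j k).
Let ddP j k := ddpen psi p (K j k) (a j k) (b j k).

Let iN_cvg : (N k)^-1 @[k --> U] --> (0 : R).
Proof. by apply/gtr0_cvgV0 => //; exact: nearW. Qed.

Let normalized_bound X : (forall k, `|X k| <= e k) -> X k / N k @[k --> U] --> (0 : R).
Proof.
move=> Xe; have X0 : X @ U --> (0 : R).
  apply/norm_cvg0P; apply: (@squeeze_cvgr _ _ _ _ (cst 0) e) => //; last exact: cvg_cst.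
  by near=> k; rewrite normr_ge0 Xe.
by have := cvgM X0 iN_cvg; rewrite mulr0; exact.
Unshelve. all: by end_near. Qed.

Let w_coord i : w k 0 i @[k --> U] --> w0 0 i.
Proof. exact: (cvg_comp _ _ w_cvg (@coord_continuous _ _ _ 0 i w0)). Qed.

Let l_coord i : l k 0 i @[k --> U] --> l0 0 i.
Proof. exact: (cvg_comp _ _ l_cvg (@coord_continuous _ _ _ 0 i l0)). Qed.

Let cvg_w (u : 'rV[R]_n -> R) : continuous u -> u (w k) @[k --> U] --> u w0.
Proof. by move=> cu; exact: (cvg_comp _ _ w_cvg (cu w0)). Qed.

Let dG_cvg i : dG i @ U --> partial (G g Rs ^~ (lbar l0)) i w0.
Proof.
rewrite /dG; under eq_fun do rewrite partial_G//; rewrite partial_G//.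
apply: cvgD; first by apply: cvg_w; apply: C1_partial_continuous; case: hg.
apply: cvg_bigsum => j; apply: cvgM.
  by under eq_fun do rewrite mxE; rewrite mxE; exact: l_coord.
by apply: cvg_w; apply: C1_partial_continuous; case: (hRs j).
Qed.

Let ddG_cvg i j : ddG i j @ U --> hess (G g Rs ^~ (lbar l0)) w0 i j.
Proof.
rewrite /ddG; under eq_fun do rewrite hess_G//; rewrite hess_G//.
apply: cvgD; first exact: (cvg_w (C2_hess_continuous (i := i) (j := j) hg)).
apply: cvg_bigsum => k; apply: cvgM.
  by under eq_fun do rewrite mxE; rewrite mxE; exact: l_coord.
exact: (cvg_w (C2_hess_continuous (i := i) (j := j) (hRs k))).
Qed.

Let bounds k := approx_KKT_bounds (kkt k).

Let l0_ge i : 0 <= l0 0 i - eps * (i == ord0)%:R.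
Proof.
have C : l k 0 i - eps * (i == ord0)%:R @[k --> U] --> l0 0 i - eps * (i == ord0)%:R.
  by apply: cvgB => //; exact: cvg_cst.
apply: (cvgr_to_ge C); near=> k.
by have [_ _ _ _ []] := bounds k.
Unshelve. all: by end_near. Qed.

Let l0_gt0 : 0 < l0 0 ord0.
Proof. by have := l0_ge ord0; rewrite eqxx mulr1 subr_ge0; exact: lt_le_trans. Qed.

Let coord_cvg (q : nat) (y : T -> 'rV[R]_q) i : (forall k i, `|y k 0 i| <= N k) ->
  exists2 t : R, (- 1 <= t <= 1) & y k 0 i / N k @[k --> U] --> t.
Proof.
move=> yN; have [k|t] := @ultra_cvg_compact T _ U (fun k => y k 0 i / N k : R)
  `[-1, 1] UU (@segment_compact _ (-1) 1).
  rewrite /= in_itv/= -ler_norml normrM normfV (gtr0_norm (N_gt0 k)).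
  by rewrite ler_pdivrMr// mul1r.
by rewrite /= in_itv /= => ht C; exists t.
Qed.

(** The Hessian of the smoothed penalty is diagonal, so its contribution to row [i] only involves
    coordinate [i] of [z]. *)
Let eq1 i k : `|partial f i (w k) + \sum_j ddG i j k * z k 0 j
  + l k 0 ord0 * ddP i k * z k 0 i| <= e k.
Proof.
have [+ _ _ _ _] := bounds k => /(_ i); congr (`|_| <= _).
rewrite -addrA; congr (_ + _).
under eq_bigr do rewrite mulrDl; rewrite big_split; congr (_ + _).
rewrite (bigD1 i)//= big1 ?addr0 => [|j ji].
  by rewrite hess_varphi// eqxx mul1r.
by rewrite hess_varphi// eq_sym (negbTE ji) mul0r mulr0 mul0r.
Qed.

(** Solve the approximate stationarity equation for the penalty derivative; the division is harmless
    because [l0 0 ord0 >= eps > 0]. *)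
Let dP_active j : w0 0 j = 0 ->
  dP j @ U --> - partial (G g Rs ^~ (lbar l0)) j w0 / l0 0 ord0.
Proof.
move=> wj; pose X k := dG j k + l k 0 ord0 * dP j k.
have X0 : X @ U --> (0 : R).
  apply/norm_cvg0P; apply: (@squeeze_cvgr _ _ _ _ (cst 0) e) => //; last exact: cvg_cst.
  near=> k; have [_ _ _ /(_ j) + _] := bounds k.
  by rewrite partial_varphi// normr_ge0.
have l_gt0 : \forall k \near U, 0 < l k 0 ord0.
  exact: (cvgr_gt _ (@l_coord ord0) _ l0_gt0).
have : (X k - dG j k) / l k 0 ord0 @[k --> U] -->
    (0 - partial (G g Rs ^~ (lbar l0)) j w0) / l0 0 ord0.
  apply: cvgM; first exact: cvgB.
  by apply: cvgV => //; exact: lt0r_neq0.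
rewrite sub0r; apply: cvg_trans; apply: near_eq_cvg; near=> k.
have lk : 0 < l k 0 ord0 by near: k.
by rewrite /X [dG j k + _]addrC addrK mulrAC mulfV ?mul1r// gt_eqF.
Unshelve. all: by end_near. Qed.

Let ddP_active j : w0 0 j = 0 -> ddP j @ U --> +oo.
Proof.
move=> wj; have wc : w k 0 j @[k --> U] --> (0 : R) by rewrite -wj.
apply: (@ddpen_cvgy R psi rho p beta hp hbeta hpsi hpsi1 hpsi2 hrho hmoment hrho_even
  hrho_cont hrho_decr hrho_tail hrho_pos T U _ m (fun k => w k 0 j)
  _ m_gt0 m_cvg wc (dP_active wj)).
(* For [p = 1] the strict inequality says precisely that this limit has modulus below [psi' 0]. *)
move=> p1; rewrite normrM normrN normfV (gtr0_norm l0_gt0) ltr_pdivrMr// mulrC.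
exact: strict.
Qed.

Let sgw j := Num.sg (w0 0 j).

Let dP_inactive j : w0 0 j != 0 -> dP j @ U --> dpen psi p `|w0 0 j| (sgw j).
Proof.
move=> wj; apply: dpen_cvg => //; first by rewrite normr_gt0.
- exact: phi_cvg.
- exact: dphi_cvg.
Qed.

Let ddP_inactive j : w0 0 j != 0 -> ddP j @ U --> ddpen psi p `|w0 0 j| (sgw j) 0.
Proof.
move=> wj; apply: ddpen_cvg => //; first by rewrite normr_gt0.
- exact: phi_cvg.
- exact: dphi_cvg.
- exact: ddphi_cvg.
Qed.

Lemma normalized_multipliers_cvg0 :
  (forall i, z k 0 i / N k @[k --> U] --> (0 : R)) /\
  (forall i, h k 0 i / N k @[k --> U] --> (0 : R)).
Proof.
have /choice [zh zhP] : forall i, exists t : R, z k 0 i / N k @[k --> U] --> t.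
  by move=> i; have [t _] := coord_cvg i zN; exists t.
have /choice [hh hhP] : forall i, exists t : R, h k 0 i / N k @[k --> U] --> t.
  by move=> i; have [t _] := coord_cvg i hN; exists t.
have uniq (u : T -> R) (x y : R) : u @ U --> x -> u @ U --> y -> x = y.
  by move=> ux uy; exact: (@norm_cvg_unique _ _ (u @ U) _ _ _ ux uy).
have S1 i : partial f i (w k) / N k + \sum_j ddG i j k * (z k 0 j / N k)
     @[k --> U] --> \sum_j hess (G g Rs ^~ (lbar l0)) w0 i j * zh j.
  rewrite -[X in _ --> X]add0r; apply: cvgD.
    rewrite -(mulr0 (partial f i w0)); apply: cvgM => //.
    by apply: cvg_w; exact: C1_partial_continuous.
  by apply: cvg_bigsum => j; exact: cvgM.
have E1 i : partial f i (w k) / N k + \sum_j ddG i j k * (z k 0 j / N k)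
     + l k 0 ord0 * ddP i k * (z k 0 i / N k) @[k --> U] --> (0 : R).
  have := normalized_bound (eq1 i); apply: cvg_trans; apply: near_eq_cvg; near=> k.
  rewrite !mulrDl mulr_suml mulrA; congr (_ + _ + _).
  by apply: eq_bigr => j _; rewrite mulrA.
(* In row [j] all other terms converge, so [l * ddP * (z / N)] has a finite limit while its factor
   [l * ddP] tends to infinity. *)
have zh_active j : w0 0 j = 0 -> zh j = 0.
  move=> wj; apply: (uniq _ _ _ (zhP j)).
  have L : l k 0 ord0 * ddP j k @[k --> U] --> +oo.
    apply/cvgryPge => A; near=> k.
    apply: (@le_trans _ _ (l0 0 ord0 / 2 * ddP j k)).
      rewrite -ler_pdivrMl ?divr_gt0//; near: k.
      by move/cvgryPge : (ddP_active wj); apply.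
    apply: ler_wpM2r.
      by near: k; move/cvgryPge : (ddP_active wj); apply.
    near: k; apply: (cvgr_ge _ (@l_coord ord0)).
    by move: l0_gt0; lra.
  have Lp : \forall k \near U, 0 < l k 0 ord0 * ddP j k by move/cvgryPgt : L; apply.
  have L' : (l k 0 ord0 * ddP j k)^-1 @[k --> U] --> (0 : R) by apply/gtr0_cvgV0.
  have L2 : l k 0 ord0 * ddP j k * (z k 0 j / N k) @[k --> U] -->
      0 - \sum_i hess (G g Rs ^~ (lbar l0)) w0 j i * zh i.
    apply: cvg_trans (cvgB (E1 j) (S1 j)); apply: near_eq_cvg; near=> k.
    by rewrite !fctE addrAC subrr add0r.
  have L3 : l k 0 ord0 * ddP j k * (z k 0 j / N k) * (l k 0 ord0 * ddP j k)^-1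
      @[k --> U] --> (0 : R).
    by have := cvgM L2 L'; rewrite mulr0; exact.
  apply: cvg_trans L3; apply: near_eq_cvg; near=> k.
  have lk : 0 < l k 0 ord0 * ddP j k by near: k.
  by rewrite mulrC mulKf// gt_eqF.
pose M := \matrix_(j < n) grad (Psi g Rs psi p w0 j) (row_mx w0 l0).
have [freeM [d [Md dpos]]] := mfcq.
have Mrow j i : M j i = grad (Psi g Rs psi p w0 j) (row_mx w0 l0) 0 i.
  by rewrite mxE.
have [zh0 hh0] : (forall j, zh j = 0) /\ (forall i, hh i = 0).
  apply: (@MFCQ_multipliers_eq0 _ _ _ M (fun j => w0 0 j == 0)
    (fun i => l0 0 i == eps_e1 r eps 0 i) zh hh d freeM).
  - by move=> j /eqP wj; rewrite rowK grad_Psi_active.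
  - by move=> j; rewrite -[RHS](Md j); apply: eq_bigr => i _; rewrite Mrow.
  - by move=> i /eqP /dpos; rewrite mxE.
  - by move=> j /eqP; exact: zh_active.
  - move=> i wi.
    have C : partial f i (w k) / N k + \sum_j ddG i j k * (z k 0 j / N k)
       + l k 0 ord0 * ddP i k * (z k 0 i / N k) @[k --> U] -->
       \sum_j hess (G g Rs ^~ (lbar l0)) w0 i j * zh j
       + l0 0 ord0 * ddpen psi p `|w0 0 i| (sgw i) 0 * zh i.
      apply: cvgD; first exact: S1.
      by apply: cvgM => //; apply: cvgM => //; exact: ddP_inactive.
    rewrite [RHS](uniq _ _ _ (E1 i) C).
    (* At a coordinate with [w0 0 j = 0] the formula for the gradient of [Psi_j] fails, but there
       [zh j = 0]. *)
    transitivity (\sum_j (hess (G g Rs ^~ (lbar l0)) w0 i j * zh j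
       + l0 0 ord0 * ((i == j)%:R * ddpen psi p `|w0 0 j| (sgw j) 0) * zh j)).
      apply: eq_bigr => j _; have [wj|wj] := eqVneq (w0 0 j) 0.
        by rewrite zh_active// mul0r !mulr0 addr0.
      by rewrite Mrow grad_Psi_lshift//; ring.
    rewrite big_split /=; congr (_ + _).
    rewrite (bigD1 i)//= big1 ?addr0 => [|j ji]; first by rewrite eqxx mul1r.
    by rewrite eq_sym (negbTE ji) mul0r mulr0 mul0r.
  - move=> i.
    (* [Dj] is the limit of [u j]. Where [w0 0 j = 0] it need not be the entry of [M], but its
       coefficient [zh j] vanishes. The value 0 is never reached, since an index other than [ord0]
       is a lift. *)
    pose Dj j := if w0 0 j == 0 then
        (if i == ord0 then - partial (G g Rs ^~ (lbar l0)) j w0 / l0 0 ord0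
         else if unlift ord0 i is Some k then partial (Rs k) j w0 else 0)
      else M j (rshift n i).
    pose u j k := if unlift ord0 i is Some k' then partial (Rs k') j (w k) else dP j k.
    have uD j : u j @ U --> Dj j.
      rewrite /u /Dj; case: unliftP => [k'|] ->.
        have -> : (lift ord0 k' == ord0) = false by [].
        case: eqVneq => wj; last rewrite Mrow grad_Psi_rshift//.
          by apply: cvg_w; apply: C1_partial_continuous; case: (hRs k').
        by apply: cvg_w; apply: C1_partial_continuous; case: (hRs k').
      case: eqVneq => wj; first by rewrite eqxx; exact: dP_active.
      by rewrite Mrow grad_Psi_rshift0//; exact: dP_inactive.
    have B k : `|\sum_j u j k * z k 0 j - h k 0 i| <= e k.
      rewrite /u; case: unliftP => [k'|] ->.
        by have [_ _ + _ _] := bounds k; apply.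
      have [_ + _ _ _] := bounds k.
      by under eq_bigr do rewrite partial_varphi//.
    have C : \sum_j u j k * (z k 0 j / N k) - h k 0 i / N k @[k --> U] -->
        \sum_j Dj j * zh j - hh i.
      apply: cvgB => //; apply: cvg_bigsum => j; exact: cvgM.
    have E : \sum_j u j k * (z k 0 j / N k) - h k 0 i / N k @[k --> U] --> (0 : R).
      have := normalized_bound B; apply: cvg_trans; apply: near_eq_cvg; near=> k.
      rewrite mulrBl mulr_suml; congr (_ - _).
      by apply: eq_bigr => j _; rewrite mulrA.
    have /eqP := uniq _ _ _ E C; rewrite eq_sym subr_eq0 => /eqP <-.
    apply: eq_bigr => j _; rewrite /Dj; case: eqVneq => wj; last by rewrite mulrC.
    by rewrite zh_active// mul0r mulr0.
  - move=> i; apply: (cvgr_to_ge (hhP i)); near=> k.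
    by rewrite divr_ge0 ?(ltW (N_gt0 _))//; have [_ _ _ _ []] := bounds k.
  - move=> i li.
    have hh_ge0 j : 0 <= hh j.
      apply: (cvgr_to_ge (hhP j)); near=> k.
      by rewrite divr_ge0 ?(ltW (N_gt0 _))//; have [_ _ _ _ []] := bounds k.
    have C : \sum_j (l k 0 j - eps * (j == ord0)%:R) * (h k 0 j / N k) @[k --> U] -->
        \sum_j (l0 0 j - eps * (j == ord0)%:R) * hh j.
      apply: cvg_bigsum => j; apply: cvgM => //; apply: cvgB => //; exact: cvg_cst.
    have E : \sum_j (l k 0 j - eps * (j == ord0)%:R) * (h k 0 j / N k)
        @[k --> U] --> (0 : R).
      have B k : `|\sum_j (l k 0 j - eps * (j == ord0)%:R) * h k 0 j| <= e k.
        by have [_ _ _ _ []] := bounds k.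
      have := normalized_bound B; apply: cvg_trans; apply: near_eq_cvg; near=> k.
      by rewrite mulr_suml; apply: eq_bigr => j _; rewrite mulrA.
    have S0 := esym (uniq _ _ _ E C).
    (* Complementarity survives in the limit as a zero sum of nonnegative products, so each product
       vanishes. *)
    have /eqP := psumr_eq0P (fun j _ => mulr_ge0 (l0_ge j) (hh_ge0 j)) S0 (i := i) isT.
    rewrite mulf_eq0 => /orP[|/eqP//].
    rewrite subr_eq0; move: li.
    by rewrite /eps_e1 mxE unitvE [ord0 == i]eq_sym => /negbTE ->.
by split=> i; [rewrite -(zh0 i)|rewrite -(hh0 i)].
Unshelve. all: by end_near. Qed.

End Normalized.

(** * Contradiction from an unbounded sequence of multipliers *)

Lemma coord_norm_le (R : realType) (q : nat) (v : 'rV[R]_q) i : `|v 0 i| <= `|v|.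
Proof.
rewrite [leRHS]/Num.norm /= mx_normrE.
by rewrite (le_bigmax _ (fun ij => `|v ij.1 ij.2|) (0, i)).
Qed.

Lemma rV_norm_le (R : realType) (q : nat) (v : 'rV[R]_q) (B : R) :
  0 <= B -> (forall i, `|v 0 i| <= B) -> `|v| <= B.
Proof.
move=> B0 vB; rewrite [leLHS]/Num.norm /= mx_normrE.
by apply/bigmax_leP; split=> // -[i j] _ /=; rewrite (ord1 i).
Qed.

Theorem proposition4p2 (R : realType) (n r : nat) (hn : (0 < n)%N)
  (f g : 'rV[R]_n -> R) (Rs : 'I_r -> 'rV[R]_n -> R)
  (psi rho : R -> R) (p eps alpha beta : R)
  (hf : C1 f) (hg : C2 g) (hRs : forall i, C2 (Rs i))
  (hp : 0 < p <= 1) (heps : 0 < eps)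
  (halpha : 0 < alpha) (hbeta : 0 < beta)
  (hpsi : C2_nneg psi)
  (hpsi1 : forall t, 0 <= t -> 0 < derive_nneg psi t <= alpha)
  (hpsi2 : forall t, 0 <= t -> - beta <= derive_nneg (derive_nneg psi) t <= 0)
  (hrho : prob_density rho) (hmoment : finite_first_moment rho)
  (hrho_even : forall x, rho x = rho (- x))
  (hrho_cont : continuous rho)
  (hrho_decr : forall x y, 0 <= x -> x <= y -> rho y <= rho x)
  (hrho_tail : exists c q : R, [/\ 0 < c, 0 < q & forall S : R, 0 <= S ->
     1 - c / (S `^ q + c) <= 2 * \int[lebesgue_measure]_(x in `[0, S]) rho x])
  (hrho_pos : p = 1 -> forall x, 0 < rho x)
  (mu0 beta1 beta2 ehat0 : R) (hmu0 : 0 < mu0)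
  (hbeta1 : 0 < beta1 < 1) (hbeta2 : 0 < beta2 < 1) (hehat0 : 0 <= ehat0)
  (omega : nat -> 'rV[R]_n) (lambda : nat -> 'rV[R]_r.+1)
  (zeta : nat -> 'rV[R]_n) (eta : nat -> 'rV[R]_r.+1)
  (halgo : smoothing_sequence f g Rs psi rho p eps
             mu0 beta1 beta2 ehat0 omega lambda zeta eta)
  (hMFCQ : forall w' lambda', accumulation_point omega lambda w' lambda' ->
     MFCQ g Rs psi p eps w' lambda')
  (hstrict : p = 1 ->
     forall w' lambda', accumulation_point omega lambda w' lambda' ->
     forall i : 'I_n, w' 0 i = 0 ->
       `|partial (G g Rs ^~ (lbar lambda')) i w'|
         < lambda' 0 ord0 * derive_nneg psi 0)
  (hbounded : [bounded row_mx (omega k) (lambda k) | k in [set: nat]]) :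
  [bounded row_mx (zeta k) (eta k) | k in [set: nat]].
Proof.
pose Z k := row_mx (zeta k) (eta k).
apply: contrapT => nb.
have unbounded (M : R) : exists k, M < `|Z k|.
  apply: contrapT => nM; apply: nb; exists M; split; first exact: num_real.
  move=> M' MM' k _; apply: le_trans (ltW MM').
  by rewrite leNgt; apply/negP => ?; apply: nM; exists k.
have /choice [kap kapP] : forall q, exists k, (q <= k)%N /\ q%:R < `|Z k.+1|.
  (* Adding the norms of the terms 0 to [q] forces [k > q], since otherwise [|Z k|] would be one of
     the summands. The successor in [Z k.+1] skips term 0, which satisfies no KKT condition. *)
  move=> q; have [k] := unbounded (q%:R + \sum_(i < q.+1) `|Z i|).
  have S0 : 0 <= \sum_(i < q.+1) `|Z i| by apply: sumr_ge0.
  have [kq|qk] := ltnP k q.+1.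
    rewrite (bigD1 (Ordinal kq))//= ltNge => /negP[].
    by rewrite addrCA lerDl addr_ge0// sumr_ge0.
  move=> lt; exists k.-1; rewrite -ltnS prednK ?(leq_trans _ qk)//; split=> //.
  by apply: le_lt_trans lt; rewrite lerDl.
have [mu [ehat [mu_0 mu_S ehat_0 ehat_S kkt]]] := halgo.
have geom (b : R) (s : nat -> R) : 0 < b < 1 -> (forall k, s k.+1 = b * s k) ->
    s @ \oo --> (0 : R).
  move=> /andP[b0 b1] sS; have sE k : s k = s 0%N * b ^+ k.
    by elim: k => [|k IH]; rewrite ?expr0 ?mulr1// sS IH exprS; ring.
  rewrite (funext sE) -(mulr0 (s 0%N)); apply: cvgM; first exact: cvg_cst.
  by apply: cvg_expr; rewrite gtr0_norm.
have mu_gt0 k : 0 < mu k.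
  by elim: k => [|k IH]; rewrite ?mu_0// mu_S mulr_gt0//; case/andP: hbeta1.
have [U [UU ooU]] := ultraFilterLemma eventually_filter.
have kap_oo : kap @ \oo --> \oo.
  move=> A [N _ NA]; exists N => // k /= Nk; apply: NA => /=.
  by apply: leq_trans Nk _; case: (kapP k).
have kapU : kap @ U --> \oo by move=> A /kap_oo; exact: ooU.
have [B wB] : exists B : R, forall k, `|row_mx (omega k) (lambda k)| <= B.
  have [B0 [_ B0P]] := hbounded.
  by exists (B0 + 1) => k; apply: B0P => //; rewrite ltrDl.
pose W k := row_mx (omega (kap k).+1) (lambda (kap k).+1).
have [||zs _ zsP] := @ultra_cvg_compact _ _ U W
    [set v | forall i, `[- B, B]%classic (v ord0 i)] UU.
- by apply: (@rV_compact _ _ (fun=> `[- B, B]%classic)) => _; exact: segment_compact.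
- move=> k i; rewrite /= in_itv/= -ler_norml.
  by apply: le_trans (wB (kap k).+1); exact: coord_norm_le.
pose w0 := lsubmx zs; pose l0 := rsubmx zs.
(* Since [kap k] tends to infinity along [U], the limit along the ultrafilter is a cluster point of
   the original sequence. *)
have acc : accumulation_point omega lambda w0 l0.
  rewrite /accumulation_point hsubmxK => A C [N _ NA] /zsP UC.
  have UN : \forall k \near U, (N <= kap k)%N := kapU _ (nbhs_infty_ge N).
  have [k [kN kC]] := filter_ex (filterI UN UC).
  by exists (W k); split => //; apply: NA => /=; exact: leqW.
have [wc lc] : (fun k => omega (kap k).+1) @ U --> w0 /\
    (fun k => lambda (kap k).+1) @ U --> l0.
  split.
    rewrite (_ : (fun k => _) = lsubmx \o W).
      exact: (cvg_comp _ _ zsP (@continuous_lsubmx _ _ _ _ zs)).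
    by apply/funext => k; rewrite /= row_mxKl.
  rewrite (_ : (fun k => _) = rsubmx \o W).
    exact: (cvg_comp _ _ zsP (@continuous_rsubmx _ _ _ _ zs)).
  by apply/funext => k; rewrite /= row_mxKr.
pose N k := `|Z (kap k).+1|.
have N_gt k : k%:R < N k by case: (kapP k).
have N_gt0 k : 0 < N k by apply: le_lt_trans (N_gt k).
have N_cvg : N @ U --> +oo.
  apply/cvgryPge => A; apply: ooU; near=> k.
  by apply: ltW; apply: le_lt_trans (N_gt k); near: k; exact: nbhs_infty_ger.
have zN k i : `|zeta (kap k).+1 0 i| <= N k.
  by rewrite -(row_mxEl (zeta _) (eta (kap k).+1)); exact: coord_norm_le.
have hN k i : `|eta (kap k).+1 0 i| <= N k.
  by rewrite -(row_mxEr (zeta (kap k).+1)); exact: coord_norm_le.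
have [zc hc] := normalized_multipliers_cvg0 hf hg hRs hp heps hbeta hpsi
  (fun t t0 => proj1 (andP (hpsi1 t t0))) hpsi2 hrho hmoment hrho_even hrho_cont
  hrho_decr hrho_tail hrho_pos UU (fun k => kkt (kap k)) (fun k => mu_gt0 (kap k))
  (cvg_comp _ _ kapU (geom _ _ hbeta1 mu_S)) (cvg_comp _ _ kapU (geom _ _ hbeta2 ehat_S))
  wc lc N_gt0 N_cvg zN hN (hMFCQ _ _ acc) (fun p1 => hstrict p1 _ _ acc).
have half (x D : R) : 0 < D -> `|x / D| <= 1 / 2 -> `|x| <= D / 2.
  by move=> D0; rewrite normrM normfV (gtr0_norm D0) ler_pdivrMr//; lra.
have near_half (q : nat) (y : nat -> 'rV[R]_q) :
    (forall i, y k 0 i / N k @[k --> U] --> (0 : R)) ->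
    \forall k \near U, forall i, `|y k 0 i| <= N k / 2.
  move=> yc; apply: filter_forall => i.
  have h0 : `|0 : R| < 1 / 2 by rewrite normr0; lra.
  near=> k; apply: half => //; near: k.
  by apply: (cvgr_norm_le _ (yc i)).
have [k [zk hk]] := filter_ex (filterI (near_half _ _ zc) (near_half _ _ hc)).
(* [N k] is the sup norm of the multiplier vector, all of whose coordinates are now at most
   [N k / 2]. *)
have : N k <= N k / 2.
  apply: rV_norm_le => [|i]; first by rewrite divr_ge0// ltW.
  by rewrite /Z mxE; case: splitP => j _; [exact: zk|exact: hk].
by move: (N_gt0 k); lra.
Unshelve. all: by end_near. Qed.
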